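(* Let $a,b$ be relatively prime integers with $a>0$, $b\neq 0$ and $a\neq 27b$, and let $c_p,\widetilde c_p$ denote the local Tamagawa numbers at a prime $p$ of $E_{C_3}(a,b)$ and $\widetilde E_{C_3}(a,b)$ respectively. (i) For every prime $p$ (including $p=3$) with $n=v_p(b)>0$, the curves have bad reduction at $p$ and $c_p=3n$, $\widetilde c_p=n$. (ii) A prime $p\neq 3$ not dividing $b$ is a prime of bad reduction if and only if either $v_p(a-27b)>0$ or $v_p(a)\not\equiv 0\pmod 3$. If $n=v_p(a-27b)>0$ and $p\equiv 1\pmod 6$, then $c_p=n$ and $\widetilde c_p=3n$; if $n=v_p(a-27b)>0$ and $p\equiv 2,5\pmod 6$, then $c_p=\widetilde c_p=2$ if $n$ is even and $c_p=\widetilde c_p=1$ if $n$ is odd. If $v_p(a)\not\equiv 0\pmod 3$, then $c_p=3$, and $\widetilde c_p=3$ if $p\equiv 1\pmod 6$, while $\widetilde c_p=1$ if $p\equiv 2,5\pmod 6$.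
   Context: For integers $a,b$, $E_{C_3}(a,b)$ is the curve $y^2+axy+a^2by=x^3$ over $\mathbb{Q}$ (with the point $(0,0)$ of order $3$), and $\widetilde E_{C_3}(a,b)$ is the curve $y^2+axy+a^2by=x^3-5a^3b\,x-a^4b(a+7b)$, which is a model of $E_{C_3}(a,b)/\langle(0,0)\rangle$. The local Tamagawa number at $p$ of an elliptic curve $E/\mathbb{Q}$ is $c_p=[E(\mathbb{Q}_p):E_0(\mathbb{Q}_p)]$, computed with respect to a $p$-minimal model, where $E_0$ denotes the points of nonsingular reduction. *)

(* Defs.v *)
From HB Require Import structures.
From mathcomp Require Import all_boot all_order all_algebra.
Set Implicit Arguments. Unset Strict Implicit. Unset Printing Implicit Defensive.
Import Order.TTheory GRing.Theory Num.Theory.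
Local Open Scope ring_scope.

Definition vQ (p : nat) (q : rat) : int :=
  (logn p (absz (numq q)))%:Z - (logn p (absz (denq q)))%:Z.

Section QpAxioms.
Variables (p : nat) (K : fieldType) (v : K -> int).

Definition vge (x : K) (N : int) : bool := (x == 0) || (N <= v x).

(* (K, v) is the completion of Q with respect to the p-adic valuation,
   i.e. (K, v) is (isomorphic to) Q_p with its normalized valuation *)
Record Qp_field : Prop := {
  val_mul : forall x y, x != 0 -> y != 0 -> v (x * y) = v x + v y;
  val_add : forall x y, x != 0 -> y != 0 -> x + y != 0 ->
              Order.min (v x) (v y) <= v (x + y);
  val_rat : forall q : rat, q != 0 -> ratr q != 0 :> K /\ v (ratr q) = vQ p q;
  rat_dense : forall (x : K) (N : int), exists q : rat, vge (x - ratr q) N;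
  complete : forall u : nat -> K,
     (forall N : int, exists M, forall m n, (M <= m)%N -> (M <= n)%N ->
        vge (u m - u n) N) ->
     exists l : K, forall N : int, exists M, forall n, (M <= n)%N -> vge (u n - l) N
}.
End QpAxioms.

(* Weierstrass equations y^2 + a1 xy + a3 y = x^3 + a2 x^2 + a4 x + a6 *)
Record weier (K : Type) := Weier { wa1 : K; wa2 : K; wa3 : K; wa4 : K; wa6 : K }.

Section Weierstrass.
Variable K : fieldType.
Implicit Types (W : weier K).

Definition disc W : K :=
  let: Weier a1 a2 a3 a4 a6 := W in
  let b2 := a1 ^+ 2 + 4 * a2 in
  let b4 := 2 * a4 + a1 * a3 in
  let b6 := a3 ^+ 2 + 4 * a6 in
  let b8 := a1 ^+ 2 * a6 + 4 * a2 * a6 - a1 * a3 * a4 + a2 * a3 ^+ 2 - a4 ^+ 2 in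
  - b2 ^+ 2 * b8 - 8 * b4 ^+ 3 - 27 * b6 ^+ 2 + 9 * b2 * b4 * b6.

(* change of variables x = u^2 x' + r, y = u^3 y' + s u^2 x' + t (Silverman Table 3.1) *)
Definition chvar W (u r s t : K) : weier K :=
  let: Weier a1 a2 a3 a4 a6 := W in
  Weier ((a1 + 2 * s) / u)
        ((a2 - s * a1 + 3 * r - s ^+ 2) / u ^+ 2)
        ((a3 + r * a1 + 2 * t) / u ^+ 3)
        ((a4 - s * a3 + 2 * r * a2 - (t + r * s) * a1 + 3 * r ^+ 2 - 2 * s * t) / u ^+ 4)
        ((a6 + r * a4 + r ^+ 2 * a2 + r ^+ 3 - t * a3 - t ^+ 2 - r * t * a1) / u ^+ 6).

(* points of E(K): None is the point at infinity O *)
Definition point := option (K * K).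

Definition on_curve W (P : point) : bool :=
  let: Weier a1 a2 a3 a4 a6 := W in
  match P with
  | None => true
  | Some (x, y) => y ^+ 2 + a1 * x * y + a3 * y == x ^+ 3 + a2 * x ^+ 2 + a4 * x + a6
  end.

Definition negp W (P : point) : point :=
  let: Weier a1 a2 a3 a4 a6 := W in
  match P with
  | None => None
  | Some (x, y) => Some (x, - y - a1 * x - a3)
  end.

Definition addp W (P Q : point) : point :=
  let: Weier a1 a2 a3 a4 a6 := W in
  match P, Q with
  | None, _ => Q
  | _, None => P
  | Some (x1, y1), Some (x2, y2) =>
    if (x1 == x2) && (y1 + y2 + a1 * x2 + a3 == 0) then None else
    let l := if x1 == x2
             then (3 * x1 ^+ 2 + 2 * a2 * x1 + a4 - a1 * y1) / (2 * y1 + a1 * x1 + a3)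
             else (y2 - y1) / (x2 - x1) in
    let nu := y1 - l * x1 in
    let x3 := l ^+ 2 + a1 * l - a2 - x1 - x2 in
    Some (x3, - (l + a1) * x3 - nu - a3)
  end.

Variable v : K -> int.

Definition integral_model W : bool :=
  [&& vge v (wa1 W) 0, vge v (wa2 W) 0, vge v (wa3 W) 0, vge v (wa4 W) 0 & vge v (wa6 W) 0].

Definition minimal_model W (W' : weier K) : Prop :=
  (exists u r s t, u != 0 /\ W' = chvar W u r s t) /\ integral_model W' /\
  forall u r s t, u != 0 -> integral_model (chvar W u r s t) ->
     v (disc W') <= v (disc (chvar W u r s t)).

(* E_0(K) for an integral model W: points whose reduction mod p is nonsingular.
   An affine point reduces to a singular point iff x, y are p-integral and both
   partial derivatives of the equation lie in pZ_p; all other points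
   (including those reducing to O) have nonsingular reduction. *)
Definition in_E0 W (P : point) : bool :=
  let: Weier a1 a2 a3 a4 a6 := W in
  match P with
  | None => true
  | Some (x, y) =>
      ~~ [&& vge v x 0, vge v y 0,
             vge v (2 * y + a1 * x + a3) 1
           & vge v (a1 * y - 3 * x ^+ 2 - 2 * a2 * x - a4) 1]
  end.

Definition index_E0 W (n : nat) : Prop :=
  exists s : seq point,
    [/\ size s = n, all (on_curve W) s,
        (forall i j, (i < n)%N -> (j < n)%N -> i <> j ->
            ~~ in_E0 W (addp W (nth None s i) (negp W (nth None s j)))) &
        forall P, on_curve W P ->
            exists2 i, (i < n)%N & in_E0 W (addp W P (negp W (nth None s i)))].

Definition tamagawa W (n : nat) : Prop :=
  (exists W', minimal_model W W') /\
  forall W', minimal_model W W' -> index_E0 W' n.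

Definition bad_reduction W : Prop :=
  exists W', minimal_model W W' /\ vge v (disc W') 1.

End Weierstrass.

Definition EC3 (K : fieldType) (a b : int) : weier K :=
  Weier (a%:~R) 0 ((a ^+ 2 * b)%:~R) 0 0.

Definition EC3t (K : fieldType) (a b : int) : weier K :=
  Weier (a%:~R) 0 ((a ^+ 2 * b)%:~R) ((- 5 * a ^+ 3 * b)%:~R)
        ((- (a ^+ 4 * b * (a + 7 * b)))%:~R).

(* Main.v *)
(* Over Q_p, a model with unit c4, or with discriminant of valuation less than 12, is minimal, and
   two minimal models differ by an integral change of variables, which preserves E_0; so it is
   enough to compute E / E_0 on one convenient model.

   A curve with multiplicative reduction can be moved so that its node is exactly the origin, with
   vanishing first-order terms, and when the tangents at the node are rational it becomes
   y^2 + x y = x^3 + c with v(c) = N = v(disc). Parametrizing the nodal cubic by x = u (u + 1), the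
   deviations A and B of a point from the two branches satisfy A B = c, and the valuation of A is
   its component in Z/N: the slope of the chord through two such points is congruent to
   - A1 A2 / (A1 A2 + c) modulo p. When the tangents are irrational, a point reducing to the node has
   min(v(x), v(y)) = N / 2 and the sum of two such points lies in E_0.

   The tangents at the node modulo p | a - 27 b, and the components of the fibre of type IV or IV*
   of the quotient curve at p | a, are rational exactly when w^2 + w + 1 has a root modulo p. *)
Require Import Defs.
From mathcomp Require Import all_boot all_order all_algebra.
From mathcomp Require Import all_fingroup all_solvable all_field.
From mathcomp Require Import zify ring.
Set Implicit Arguments. Unset Strict Implicit. Unset Printing Implicit Defensive.
Import Order.TTheory GRing.Theory Num.Theory.
Local Open Scope ring_scope.

(** * The valuation *)

(** The index of E_0 is expressed by representatives with pairwise differences outside E_0, so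
    associativity of the addition law never enters: everything reduces to deciding whether the sum
    of two explicit points has nonsingular reduction, that is, to the residue of one slope.

    Part (i) allows every prime and part (ii) allows p = 2, so short Weierstrass forms are out of
    reach. Tangents at a node are therefore described by the roots l of l^2 + a1 l - a2, and a node
    is separated from a cusp by [b2] being a unit, a condition that still makes sense at 2. All
    liftings to Q_p are instances of one Newton iteration for cubics with unit linear coefficient.

    The number -3 governs the rationality questions: at p | a - 27 b the tangent quadratics of the
    two curves have discriminants - a^2 / 3 and - 3 a^2, and at p | a the quadratic of the quotient
    curve has discriminant - 27 up to a square, modulo p. The original curve at p | a instead has
    the quadratic Y (Y + g), which always splits. *)

Section Valuation.
Variables (p : nat) (K : fieldType) (v : K -> int).
Hypothesis Qp : Qp_field p v.
Implicit Types (x y z : K) (N M : int).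

Lemma val1 : v 1 = 0.
Proof. apply: (addrI (v 1)); rewrite addr0.
by rewrite -[in LHS](val_mul Qp (oner_neq0 K) (oner_neq0 K)) mulr1.
Qed.

Lemma valN x : v (- x) = v x.
Proof.
have N10 : (-1 : K) != 0 by rewrite oppr_eq0 oner_neq0.
have vN1 : v (-1) = 0.
  by have := val_mul Qp N10 N10; rewrite mulrNN mulr1 val1; lia.
have [->|x0] := eqVneq x 0; first by rewrite oppr0.
by rewrite -mulN1r (val_mul Qp) // vN1 add0r.
Qed.

Lemma valV x : x != 0 -> v x^-1 = - v x.
Proof.
move=> x0; have xV0 : x^-1 != 0 by rewrite invr_eq0.
by have := val_mul Qp x0 xV0; rewrite mulfV // val1; lia.
Qed.

Lemma vge0 N : vge v 0 N. Proof. by rewrite /vge eqxx. Qed.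

Lemma vgeW x N M : M <= N -> vge v x N -> vge v x M.
Proof. by rewrite /vge => MN /orP[->//|xN]; rewrite (le_trans MN xN) orbT. Qed.

Lemma vgeN x N : vge v (- x) N = vge v x N.
Proof. by rewrite /vge oppr_eq0 valN. Qed.

Lemma vgeD x y N : vge v x N -> vge v y N -> vge v (x + y) N.
Proof.
rewrite /vge; have [->|x0] := eqVneq x 0; first by rewrite add0r.
have [->|y0] := eqVneq y 0; first by rewrite addr0 (negPf x0).
rewrite /=; have [//|xy0] := eqVneq (x + y) 0 => /= Nx Ny.
by apply: le_trans (val_add Qp x0 y0 xy0); rewrite le_min Nx Ny.
Qed.

Lemma vgeB x y N : vge v x N -> vge v y N -> vge v (x - y) N.
Proof. by move=> xN yN; apply: vgeD; rewrite ?vgeN. Qed.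

Lemma vgeM x y N M : vge v x N -> vge v y M -> vge v (x * y) (N + M).
Proof.
rewrite /vge mulf_eq0; have [//|x0] := eqVneq x 0.
have [//|y0] := eqVneq y 0; rewrite /= (val_mul Qp) //; lia.
Qed.

Lemma vge1 : vge v 1 0.
Proof. by rewrite /vge val1 lexx orbT. Qed.

Lemma vgeX x N (k : nat) : vge v x N -> vge v (x ^+ k) (k%:Z * N).
Proof.
move=> xN; elim: k => [|k IHk]; first by rewrite mul0r vge1.
by rewrite exprS -addn1 PoszD mulrDl mul1r addrC; apply: vgeM.
Qed.

Lemma vge_add_l x y N : vge v x N -> vge v (x + y) N = vge v y N.
Proof.
move=> xN; apply/idP/idP => [xyN|yN]; last exact: vgeD.
by rewrite (_ : y = x + y - x); [exact: vgeB | ring].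
Qed.

Lemma vge_add_r x y N : vge v y N -> vge v (x + y) N = vge v x N.
Proof. by rewrite addrC; apply: vge_add_l. Qed.

Lemma vge_nat (k : nat) : vge v k%:R 0.
Proof.
elim: k => [|k IHk]; first exact: vge0.
by rewrite -addn1 natrD; apply: vgeD => //; apply: vge1.
Qed.

Lemma vge_int (k : int) : vge v k%:~R 0.
Proof. by case: k => k; rewrite ?NegzE ?rmorphN ?vgeN; apply: vge_nat. Qed.


Lemma intr_neq0 (k : int) : k != 0 -> (k%:~R : K) != 0.
Proof.
by move=> k0; have /(val_rat Qp)[] : (k%:~R : rat) != 0; rewrite ?intr_eq0 // ratr_int.
Qed.

Lemma val_int (k : int) : k != 0 -> v k%:~R = logn p `|k|%N.
Proof.
move=> k0; have /(val_rat Qp)[_] : (k%:~R : rat) != 0 by rewrite intr_eq0.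
by rewrite ratr_int => ->; rewrite /vQ numq_int denq_int /= logn1 subr0.
Qed.

Lemma natr_neq0 (k : nat) : (0 < k)%N -> (k%:R : K) != 0.
Proof. by move=> k0; rewrite pmulrn intr_neq0 //; lia. Qed.

(** The integer [v 0] is arbitrary. Stating an exact valuation through [vge] excludes zero and never
    consults that value. *)
Definition veq x N := vge v x N && ~~ vge v x (N + 1).

Lemma veqE x N : veq x N = (x != 0) && (v x == N).
Proof. by rewrite /veq /vge; case: (x == 0) => //=; lia. Qed.

Lemma veq_val x : x != 0 -> veq x (v x).
Proof. by rewrite veqE => ->; rewrite eqxx. Qed.

Lemma veq_vge x N : veq x N -> vge v x N.
Proof. by case/andP. Qed.

Lemma veq_neq0 x N : veq x N -> x != 0.
Proof. by rewrite veqE => /andP[]. Qed.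

Lemma veqM x y N M : veq x N -> veq y M -> veq (x * y) (N + M).
Proof.
rewrite !veqE mulf_eq0 => /andP[x0 /eqP vx] /andP[y0 /eqP vy].
by rewrite (val_mul Qp) // vx vy (negPf x0) (negPf y0) /=.
Qed.

Lemma veqV x N : veq x N -> veq x^-1 (- N).
Proof. by rewrite !veqE invr_eq0 => /andP[x0 /eqP vx]; rewrite valV // vx x0 /=. Qed.

Lemma veq1 : veq 1 0.
Proof. by rewrite veqE oner_neq0 val1. Qed.

Lemma veqX x N (k : nat) : veq x N -> veq (x ^+ k) (k%:Z * N).
Proof.
move=> xN; elim: k => [|k IHk]; first by rewrite mul0r veq1.
by rewrite exprS -addn1 PoszD mulrDl mul1r addrC; apply: veqM.
Qed.

Lemma veqX0 x (k : nat) : veq x 0 -> veq (x ^+ k) 0.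
Proof. by move=> x0; have := veqX k x0; rewrite mulr0. Qed.

Lemma veqN x N : veq (- x) N = veq x N.
Proof. by rewrite /veq !vgeN. Qed.

Lemma veqD x y N : veq x N -> vge v y (N + 1) -> veq (x + y) N.
Proof.
move=> /andP[xN xN1] yN; rewrite /veq (vge_add_r _ yN) xN1.
by rewrite vge_add_r ?xN //; apply: vgeW yN; lia.
Qed.

Lemma veqD' x y N : vge v x (N + 1) -> veq y N -> veq (x + y) N.
Proof. by move=> xN yN; rewrite addrC; apply: veqD. Qed.

Lemma vge_mul_veq x y N M : veq x N -> vge v (x * y) (N + M) = vge v y M.
Proof.
rewrite veqE /vge => /andP[x0 /eqP vx]; rewrite mulf_eq0 (negPf x0) /=.
have [//|y0] := eqVneq y 0; rewrite (val_mul Qp) // vx /=; lia.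
Qed.

Lemma veq_int (k : int) (n : nat) : k != 0 -> logn p `|k|%N = n -> veq k%:~R n.
Proof. by move=> k0 <-; rewrite veqE intr_neq0 //= val_int. Qed.

(** Valuations are integers, so halving rounds up and 2 N - 1 is already enough; likewise 3 N - 2
    for cubes below. *)
Lemma vge_sqr x N : vge v (x ^+ 2) (2 * N - 1) -> vge v x N.
Proof.
rewrite /vge expf_eq0 /=; have [//|x0] := eqVneq x 0.
by rewrite expr2 (val_mul Qp) //=; lia.
Qed.

Lemma vge_cube x N : vge v (x ^+ 3) (3 * N - 2) -> vge v x N.
Proof.
rewrite /vge expf_eq0 /=; have [//|x0] := eqVneq x 0.
by rewrite !exprS expr0 mulr1 !(val_mul Qp) ?mulf_neq0 //=; lia.
Qed.

Lemma vge_mul_split x y N : vge v (x * y) (2 * N - 1) -> vge v x N \/ vge v y N.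
Proof.
rewrite /vge mulf_eq0; have [|x0] := eqVneq x 0; first by left.
have [|y0] := eqVneq y 0; first by right.
rewrite (val_mul Qp) //=; lia.
Qed.

Lemma vgeM0 x y : vge v x 0 -> vge v y 0 -> vge v (x * y) 0.
Proof. by move=> x0 y0; rewrite -[0]addr0; apply: vgeM. Qed.

Lemma vgeMl x y N : vge v x N -> vge v y 0 -> vge v (x * y) N.
Proof. by move=> xN y0; rewrite -[N]addr0; apply: vgeM. Qed.

Lemma vgeMr x y N : vge v x 0 -> vge v y N -> vge v (x * y) N.
Proof. by move=> xN y0; rewrite -[N]add0r; apply: vgeM. Qed.

Lemma vgeX0 x k : vge v x 0 -> vge v (x ^+ k) 0.
Proof. by move=> x0; have := vgeX k x0; rewrite mulr0. Qed.

Lemma vgeXS x k N : 0 <= N -> vge v x N -> vge v (x ^+ k.+1) N.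
Proof.
move=> N0 xN; rewrite exprS; apply: vgeMl => //.
by apply: vgeX0; apply: vgeW xN.
Qed.

Lemma vge_div x y N M : veq y M -> vge v (x / y) N = vge v x (N + M).
Proof.
move=> yM; rewrite -(vge_mul_veq _ _ yM) [y * _]mulrC divfK ?(veq_neq0 yM) //.
by rewrite addrC.
Qed.

Lemma veq_div x y N M : veq y M -> veq (x / y) N = veq x (N + M).
Proof.
by move=> yM; rewrite /veq !(vge_div _ _ yM) (_ : N + 1 + M = N + M + 1) //; lia.
Qed.

Lemma veq_uniq x N M : veq x N -> veq x M -> N = M.
Proof. by rewrite !veqE => /andP[_ /eqP<-] /andP[_ /eqP]. Qed.

(* Newton iteration: the map [z |-> - (c0 + c2 z^2 + c3 z^3) / c1] contracts the maximal ideal. *)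
Lemma hensel_cubic c0 c1 c2 c3 :
  vge v c0 1 -> veq c1 0 -> vge v c2 0 -> vge v c3 0 ->
  exists2 z, vge v z 1 & c0 + c1 * z + c2 * z ^+ 2 + c3 * z ^+ 3 = 0.
Proof.
move=> c0s c1u c2i c3i.
pose T z := - (c0 + c2 * z ^+ 2 + c3 * z ^+ 3) / c1.
have c1V : vge v c1^-1 0 by apply: veq_vge; apply: (veqV c1u).
have Ti z : vge v z 1 -> vge v (T z) 1.
  move=> zs; rewrite /T -[1]addr0 vgeM // vgeN; apply: vgeD; first apply: vgeD => //.
    by apply: (@vgeW _ (0 + 2%:Z * 1)) => //; apply: vgeM => //; apply: vgeX.
  by apply: (@vgeW _ (0 + 3%:Z * 1)) => //; apply: vgeM => //; apply: vgeX.
have TB y z N : vge v y 1 -> vge v z 1 -> vge v (y - z) N -> vge v (T y - T z) (N + 1).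
  move=> ys zs yzN.
  have -> : T y - T z =
    (y - z) * - ((c2 * (y + z) + c3 * (y * y + z * (y + z))) / c1).
    by rewrite /T; ring.
  apply: vgeM => //; rewrite vgeN -[1]addr0; apply: vgeM => //.
  have yzs : vge v (y + z) 1 by apply: vgeD.
  apply: vgeD; rewrite -[1]add0r; apply: vgeM => //.
  by apply: vgeD; apply: (@vgeW _ (1 + 1)) => //; apply: vgeM.
pose u n := iter n T 0.
have us n : vge v (u n) 1 by elim: n => [|n IHn] /=; [apply: vge0 | apply: Ti].
have uS n : vge v (u n.+1 - u n) n%:Z.
  elim: n => [|n IHn]; first by apply: vgeW (vgeB (us _) (us _)).
  have -> : Posz n.+1 = n%:Z + 1 by lia.
  exact: (TB _ _ _ (us n.+1) (us n) IHn).
have uC m k : vge v (u (m + k)%N - u m) m%:Z.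
  elim: k => [|k IHk]; first by rewrite addn0 subrr vge0.
  rewrite addnS -(subrKA (u (m + k)%N)); apply: vgeD => //.
  by apply: vgeW (uS _); lia.
have [N|l ul] := complete Qp (u := u).
  exists `|N|%N => m n Nm Nn.
  apply: (@vgeW _ `|N|%N%:Z); first lia.
  have -> : u m - u n = (u m - u `|N|%N) - (u n - u `|N|%N) by ring.
  by apply: vgeB; [rewrite -(subnKC Nm) | rewrite -(subnKC Nn)]; apply: uC.
have ls : vge v l 1.
  have [M /(_ M (leqnn M)) h] := ul 1.
  by rewrite (_ : l = u M - (u M - l)); [apply: vgeB | ring].
have lT : l = T l.
  apply/eqP; rewrite -subr_eq0; apply/negPn/negP => lT0.
  (* [N] exceeds the valuation of the supposedly nonzero [l - T l], so reaching [vge] at [N] is a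
     contradiction; both [u M] and its image [u M.+1] are close to [l]. *)
  pose N : int := v (l - T l) + 1.
  have [M /[dup] /(_ M (leqnn M)) h1 /(_ M.+1 (leqnSn M)) h2] := ul N.
  have h3 := TB _ _ _ (us M) ls h1.
  have : vge v (l - T l) N.
    rewrite (_ : l - T l = (T (u M) - T l) - (u M.+1 - l)); last by rewrite /=; ring.
    by apply: vgeB => //; apply: vgeW h3; lia.
  by rewrite /vge (negPf lT0) /= /N; lia.
exists l => //; rewrite {1}lT /T.
have c10 := veq_neq0 c1u.
by field.
Qed.

Hypothesis pp : prime p.

Lemma vge_intE (k : int) (n : nat) : vge v k%:~R n = (p ^ n %| `|k|)%N.
Proof.
have [->|k0] := eqVneq k 0; first by rewrite vge0 dvdn0.
by rewrite /vge (negPf (intr_neq0 k0)) /= val_int // pfactor_dvdn //; lia.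
Qed.

Lemma unit_int (k : int) : ~~ (p %| `|k|)%N -> veq k%:~R 0.
Proof. by rewrite /veq vge_int (vge_intE _ 1) expn1. Qed.

Lemma unit_nat (k : nat) : ~~ (p %| k)%N -> veq k%:R 0.
Proof. exact: (@unit_int (Posz k)). Qed.

Lemma veq_p : veq p%:R 1.
Proof.
rewrite pmulrn; apply: veq_int; first by have := prime_gt0 pp; lia.
by rewrite logn_prime // eqxx.
Qed.

Lemma veq_pz N : veq (p%:R ^ N) N.
Proof.
case: N => k; rewrite ?NegzE -?exprnN -?exprnP; last apply: veqV.
  by have := veqX k veq_p; rewrite mulr1.
by have := veqX k.+1 veq_p; rewrite mulr1.
Qed.

(** Density replaces x by a rational that is integral at p, and inverting its denominator modulo p
    leaves a natural number. *)
Lemma residue x : vge v x 0 -> exists k : nat, vge v (x - k%:R) 1.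
Proof.
move=> xi; have [q qx] := rat_dense Qp x 1.
have [k kq] : exists k : nat, vge v (ratr q - k%:R) 1; last first.
  by exists k; rewrite -(subrKA (ratr q)); apply: vgeD.
have qi : vge v (ratr q) 0.
  rewrite (_ : ratr q = x - (x - ratr q)); last by ring.
  by apply: vgeB => //; apply: vgeW qx.
have pd : ~~ (p %| `|denq q|)%N.
  apply/negP => pd.
  have pn : (p %| `|numq q|)%N.
    rewrite -[p]expn1 -vge_intE -(divfK (intr_neq0 (denq_neq0 q)) (numq q)%:~R).
    rewrite -[Posz 1]add0r; apply: vgeM => //; by rewrite vge_intE.
  have := coprime_num_den q; rewrite /coprime => /eqP g1.
  have : (p %| gcdn `|numq q| `|denq q|)%N by rewrite dvdn_gcd pn pd.
  by rewrite g1 dvdn1 => /eqP p1; move: pp; rewrite p1.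
(* Bezout gives [c] inverse to the denominator modulo p; the residue is then the remainder of
   [c * numq q]. *)
have cpd : coprimez (denq q) p.
  by rewrite coprimez_sym /coprimez /gcdz; move: pd; rewrite -prime_coprime.
have [[c d] cd] := coprimezP _ _ cpd.
have p0 := prime_gt0 pp.
have [k [e [k0 kE]]] : exists k e, 0 <= k /\ c * numq q = e * p%:Z + k.
  exists (c * numq q %% p)%Z, (c * numq q %/ p)%Z; rewrite modz_ge0; last lia.
  by split=> //; apply: divz_eq.
exists `|k|%N; rewrite pmulrn gez0_abs //.
have d0 : ((denq q)%:~R : K) != 0 := intr_neq0 (denq_neq0 q).
have -> : ratr q - k%:~R = (numq q - k * denq q)%:~R / (denq q)%:~R :> K.
  by rewrite rmorphB rmorphM /= mulrBl mulfK.
rewrite (vge_div _ _ (unit_int pd)) addr0.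
rewrite (_ : numq q - k * denq q = p%:Z * (numq q * d + e * denq q)).
  by rewrite rmorphM -[1]addr0; apply: vgeM; [apply: veq_vge veq_p | apply: vge_int].
have -> : k = c * numq q - e * p%:Z by rewrite kE; ring.
rewrite -[X in X - _]mulr1 -cd /=; ring.
Qed.

End Valuation.

(** Facts about field elements are cleared first, so that [lia] sees only the arithmetic of
    exponents. *)
Ltac vlia :=
  repeat match goal with
  | H : is_true (prime _) |- _ => clear H
  | H : is_true (vge _ _ _) |- _ => clear H
  | H : is_true (veq _ _ _) |- _ => clear H
  | H : is_true (on_curve _ _) |- _ => clear H
  | H : @eq (GRing.Field.sort _) _ _ |- _ => clear H
  | H : is_true (negb (@eq_op (GRing.Field.sort _) _ _)) |- _ => clear H
  | H : is_true (negb (@eq_op _ _ (GRing.zero))) |- _ => clear H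
  | H := _ : GRing.Field.sort _ |- _ => clearbody H
  end; lia.

(** Bounds are derived along the shape of the term. In a product one factor carries the whole bound
    and the other is merely integral; bounds shared between factors are proved by hand with
    [vgeM]. *)
Ltac vsolve Q :=
  first
  [ match goal with
    | H : is_true (vge _ ?x _) |- is_true (vge _ ?y _) =>
        constr_eq x y; solve [exact H | apply: (vgeW _ H); first [done | vlia]]
    | H : is_true (veq _ ?x _) |- is_true (vge _ ?y _) =>
        constr_eq x y; solve [apply: (vgeW _ (veq_vge H)); first [done | vlia]]
    end
  | lazymatch goal with
    | |- is_true (vge _ (_ + - _) _) => apply: (vgeB Q); vsolve Q
    | |- is_true (vge _ (_ + _) _) => apply: (vgeD Q); vsolve Q
    | |- is_true (vge _ (- _) _) => rewrite (vgeN Q); vsolve Q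
    | |- is_true (vge _ (_ * _) _) =>
        first [ solve [apply: (vgeM0 Q); vsolve Q]
              | solve [apply: (vgeMl Q); vsolve Q]
              | solve [apply: (vgeMr Q); vsolve Q] ]
    | |- is_true (vge _ (_ ^+ _) _) =>
        first [ solve [apply: (vgeX0 Q); vsolve Q]
              | solve [apply: (vgeXS Q); [first [done | vlia] | vsolve Q]] ]
    | |- is_true (vge _ (_^-1) _) => assumption
    | |- is_true (vge _ 0 _) => apply: vge0
    | |- is_true (vge _ 1 0) => apply: (vge1 Q)
    | |- is_true (vge _ (_%:R) _) => first [apply: (vge_nat Q) | assumption]
    | |- is_true (vge _ (_%:~R) 0) => apply: (vge_int Q)
    end ].

(** * Weierstrass equations *)

Section ChangeOfVariables.
Variable K : fieldType.
Implicit Types (W : weier K) (u r s t x y : K) (P : point K).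

Definition b2 W := wa1 W ^+ 2 + 4 * wa2 W.
Definition b4 W := 2 * wa4 W + wa1 W * wa3 W.
Definition b6 W := wa3 W ^+ 2 + 4 * wa6 W.
Definition b8 W := wa1 W ^+ 2 * wa6 W + 4 * wa2 W * wa6 W - wa1 W * wa3 W * wa4 W
  + wa2 W * wa3 W ^+ 2 - wa4 W ^+ 2.
Definition c4 W := b2 W ^+ 2 - 24 * b4 W.

Lemma discE W : disc W = - b2 W ^+ 2 * b8 W - 8 * b4 W ^+ 3 - 27 * b6 W ^+ 2
  + 9 * b2 W * b4 W * b6 W.
Proof. by case: W. Qed.

Lemma chvar_id W : chvar W 1 0 0 0 = W.
Proof. by case: W => * /=; f_equal; field; rewrite ?oner_neq0. Qed.

Lemma chvar_comp W u r s t u' r' s' t' : u != 0 -> u' != 0 ->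
  chvar (chvar W u r s t) u' r' s' t' =
  chvar W (u * u') (u ^+ 2 * r' + r) (u * s' + s) (u ^+ 3 * t' + u ^+ 2 * s * r' + t).
Proof. by case: W => * /=; f_equal; field; apply/andP. Qed.

Lemma b2_chvar W u r s t : u != 0 -> u ^+ 2 * b2 (chvar W u r s t) = b2 W + 12 * r.
Proof. by case: W => * ; rewrite /b2 /=; field. Qed.

Lemma b4_chvar W u r s t : u != 0 ->
  u ^+ 4 * b4 (chvar W u r s t) = b4 W + r * b2 W + 6 * r ^+ 2.
Proof. by case: W => * ; rewrite /b2 /b4 /=; field. Qed.

Lemma b6_chvar W u r s t : u != 0 ->
  u ^+ 6 * b6 (chvar W u r s t) = b6 W + 2 * r * b4 W + r ^+ 2 * b2 W + 4 * r ^+ 3.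
Proof. by case: W => * ; rewrite /b2 /b4 /b6 /=; field. Qed.

Lemma b8_chvar W u r s t : u != 0 -> u ^+ 8 * b8 (chvar W u r s t) =
  b8 W + 3 * r * b6 W + 3 * r ^+ 2 * b4 W + r ^+ 3 * b2 W + 3 * r ^+ 4.
Proof. by case: W => * ; rewrite /b2 /b4 /b6 /b8 /=; field. Qed.

Lemma c4_chvar W u r s t : u != 0 -> u ^+ 4 * c4 (chvar W u r s t) = c4 W.
Proof.
move=> u0; rewrite /c4; transitivity ((u ^+ 2 * b2 (chvar W u r s t)) ^+ 2
  - 24 * (u ^+ 4 * b4 (chvar W u r s t))); first by ring.
rewrite b2_chvar // b4_chvar //; ring.
Qed.

Lemma disc_chvar W u r s t : u != 0 -> u ^+ 12 * disc (chvar W u r s t) = disc W.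
Proof.
move=> u0; rewrite !discE; set W' := chvar _ _ _ _ _.
transitivity (- (u ^+ 2 * b2 W') ^+ 2 * (u ^+ 8 * b8 W') - 8 * (u ^+ 4 * b4 W') ^+ 3
  - 27 * (u ^+ 6 * b6 W') ^+ 2 + 9 * (u ^+ 2 * b2 W') * (u ^+ 4 * b4 W') * (u ^+ 6 * b6 W')).
  by ring.
rewrite b2_chvar // b4_chvar // b6_chvar // b8_chvar //.
(* The four quantities satisfy 4 b8 = b2 b6 - b4^2, and the invariance under r depends on this
   relation, hence the unfolding. *)
rewrite /b2 /b4 /b6 /b8; ring.
Qed.

Definition chpt u r s t P : point K :=
  if P is Some (x, y) then
    Some ((x - r) / u ^+ 2, (y - s * (x - r) - t) / u ^+ 3)
  else None.

Lemma on_curve_chpt W u r s t P : u != 0 ->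
  on_curve (chvar W u r s t) (chpt u r s t P) = on_curve W P.
Proof.
move=> u0; case: W P => a1 a2 a3 a4 a6 [[x y]|] //=.
have u60 : u ^+ 6 != 0 by rewrite expf_eq0.
rewrite -[RHS]subr_eq0 -subr_eq0 -[RHS](mulrI_eq0 _ (mulfI (invr_neq0 u60))).
by congr (_ == 0); field.
Qed.

Lemma negp_chpt W u r s t P : u != 0 ->
  negp (chvar W u r s t) (chpt u r s t P) = chpt u r s t (negp W P).
Proof.
move=> u0; case: W P => a1 a2 a3 a4 a6 [[x y]|] //=.
by congr (Some (_, _)); field.
Qed.

Lemma chpt_eq_x u r x1 x2 : u != 0 ->
  ((x1 - r) / u ^+ 2 == (x2 - r) / u ^+ 2) = (x1 == x2).
Proof.
move=> u0; have u20 : u ^+ 2 != 0 by rewrite expf_eq0.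
by rewrite (inj_eq (divIf u20)) (inj_eq (addIr _)).
Qed.

(* In the doubling formula the denominator vanishes only in the already excluded case
   [Q = - P]. *)
Lemma addp_chpt W u r s t P Q : u != 0 -> on_curve W P -> on_curve W Q ->
  addp (chvar W u r s t) (chpt u r s t P) (chpt u r s t Q) = chpt u r s t (addp W P Q).
Proof.
move=> u0; case: W P Q => a1 a2 a3 a4 a6 [[x1 y1]|] [[x2 y2]|] //.
rewrite /on_curve => /eqP e1 /eqP e2.
rewrite /chvar /chpt /addp chpt_eq_x //.
have u30 : u ^+ 3 != 0 by rewrite expf_eq0.
have -> : ((y1 - s * (x1 - r) - t) / u ^+ 3 + (y2 - s * (x2 - r) - t) / u ^+ 3 +
   (a1 + 2 * s) / u * ((x2 - r) / u ^+ 2) + (a3 + r * a1 + 2 * t) / u ^+ 3 == 0)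
   = (y1 + y2 + a1 * x2 + a3 - s * (x1 - x2) == 0).
  rewrite -[RHS](mulrI_eq0 _ (mulfI (invr_neq0 u30))).
  by congr (_ == 0); field.
have [x12|x12] := eqVneq x1 x2; last first.
  rewrite /=; have x21 : x2 - x1 != 0 by rewrite subr_eq0 eq_sym.
  by congr (Some (_, _)); field; rewrite u0 x21.
rewrite /= x12 subrr mulr0 subr0; case: eqP => //= /eqP d.
have y12 : y1 = y2.
  apply/eqP; rewrite -subr_eq0; have : (y1 - y2) * (y1 + y2 + a1 * x2 + a3) = 0.
    transitivity ((y1 ^+ 2 + a1 * x1 * y1 + a3 * y1) - (y2 ^+ 2 + a1 * x2 * y2 + a3 * y2)).
      by rewrite x12; ring.
    by rewrite e1 e2 x12; ring.
  by move/eqP; rewrite mulf_eq0 (negPf d) orbF.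
subst y2.
have d' : 2 * y1 + a1 * x2 + a3 != 0 by apply: contraNneq d => <-; apply/eqP; ring.
by congr (Some (_, _)); field; rewrite u0 d'.
Qed.

Lemma chptK W u r s t P' : u != 0 -> on_curve (chvar W u r s t) P' ->
  exists2 P, on_curve W P & P' = chpt u r s t P.
Proof.
move=> u0 oc; suff [P PE] : exists P, P' = chpt u r s t P.
  by exists P => //; rewrite -(on_curve_chpt _ r s t _ u0) -PE.
case: P' {oc} => [[x y]|]; last by exists None.
exists (Some (u ^+ 2 * x + r, u ^+ 3 * y + s * u ^+ 2 * x + t)).
by congr (Some (_, _)); field.
Qed.

(* For doubling the second equation is trivial, and otherwise the first one follows from it, so
   that the pair treats the chord and the tangent uniformly. *)
Lemma addp_slope W x1 y1 x2 y2 : on_curve W (Some (x1, y1)) -> on_curve W (Some (x2, y2)) ->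
  (x1 = x2 /\ addp W (Some (x1, y1)) (Some (x2, y2)) = None /\
     y1 + y2 + wa1 W * x2 + wa3 W = 0) \/
  exists l, [/\ l * (x1 - x2) = y1 - y2,
   l * (y1 + y2 + wa1 W * x1 + wa3 W) =
     x1 ^+ 2 + x1 * x2 + x2 ^+ 2 + wa2 W * (x1 + x2) + wa4 W - wa1 W * y2 &
   let x3 := l ^+ 2 + wa1 W * l - wa2 W - x1 - x2 in
   addp W (Some (x1, y1)) (Some (x2, y2)) =
     Some (x3, - (l + wa1 W) * x3 - (y1 - l * x1) - wa3 W)].
Proof.
case: W => a1 a2 a3 a4 a6; rewrite /on_curve /= => /eqP e1 /eqP e2.
have h : (y1 - y2) * (y1 + y2 + a1 * x1 + a3) =
  (x1 - x2) * (x1 ^+ 2 + x1 * x2 + x2 ^+ 2 + a2 * (x1 + x2) + a4 - a1 * y2).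
  transitivity ((y1 ^+ 2 + a1 * x1 * y1 + a3 * y1) - (y2 ^+ 2 + a1 * x2 * y2 + a3 * y2)
    - a1 * y2 * (x1 - x2)); first by ring.
  by rewrite e1 e2; ring.
have [x12|x12] := eqVneq x1 x2; last first.
  right; exists ((y2 - y1) / (x2 - x1)).
  have x12' : x1 - x2 != 0 by rewrite subr_eq0.
  have x21 : x2 - x1 != 0 by rewrite subr_eq0 eq_sym.
  split => //; first by field.
  by apply: (mulfI x12'); rewrite -h; field.
subst x2; have [/= d|/= d] := eqVneq (y1 + y2 + a1 * x1 + a3) 0; [left | right] => //.
have y12 : y1 = y2.
  apply/eqP; rewrite -subr_eq0; move/eqP: h.
  by rewrite subrr mul0r mulf_eq0 (negPf d) orbF.
subst y2.
have d' : 2 * y1 + a1 * x1 + a3 != 0 by apply: contraNneq d => <-; apply/eqP; ring.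
exists ((3 * x1 ^+ 2 + 2 * a2 * x1 + a4 - a1 * y1) / (2 * y1 + a1 * x1 + a3)); split => //.
  by rewrite !subrr mulr0.
by field.
Qed.

Lemma addp0 W P : addp W P None = P.
Proof. by case: W P => a1 a2 a3 a4 a6 [[]|]. Qed.

Lemma add0p W P : addp W None P = P.
Proof. by case: W P => a1 a2 a3 a4 a6 [[]|]. Qed.

Lemma negp0 W : negp W None = None.
Proof. by case: W. Qed.

Lemma negpE W x y : negp W (Some (x, y)) = Some (x, - y - wa1 W * x - wa3 W).
Proof. by case: W. Qed.

Lemma on_curve_addp W P Q : on_curve W P -> on_curve W Q -> on_curve W (addp W P Q).
Proof.
case: P Q => [[x1 y1]|] [[x2 y2]|] oP oQ; rewrite ?addp0 ?add0p //.
have [[_ [-> _]]|] := addp_slope oP oQ; first by case: (W).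
case: W oP oQ => a1 a2 a3 a4 a6; rewrite /on_curve => /eqP e1 _ [l /= [l1 l2 ->]].
  (* Eliminating [y2], [a4] and [a6] through the slope equations and the curve equation makes the
     claim a polynomial identity. *)
  have y2E : y2 = y1 - l * (x1 - x2) by rewrite l1; ring.
  have a4E : a4 = l * (2 * y1 - l * (x1 - x2) + a1 * x1 + a3) - (x1 ^+ 2 + x1 * x2 + x2 ^+ 2)
    - a2 * (x1 + x2) + a1 * (y1 - l * (x1 - x2)).
    rewrite -y2E (_ : 2 * y1 - l * (x1 - x2) = y1 + y2); last by rewrite l1; ring.
    by rewrite l2; ring.
  have a6E : a6 = y1 ^+ 2 + a1 * x1 * y1 + a3 * y1 - (x1 ^+ 3 + a2 * x1 ^+ 2 + a4 * x1).
    by rewrite e1; ring.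
  by apply/eqP; rewrite a6E a4E; ring.
Qed.

Lemma on_curve_negp W P : on_curve W P -> on_curve W (negp W P).
Proof. by case: W P => a1 a2 a3 a4 a6 [[x y]|] //= /eqP e; apply/eqP; rewrite -e; ring. Qed.

End ChangeOfVariables.

(** * Minimal models *)

Section MinimalModels.
Variables (p : nat) (K : fieldType) (v : K -> int).
Hypotheses (pp : prime p) (Qp : Qp_field p v).
Implicit Types (W : weier K) (u r s t x y : K) (P : point K).

Definition wiso W W' := exists u r s t, u != 0 /\ W' = chvar W u r s t.

Lemma wiso_chvar W u r s t : u != 0 -> wiso W (chvar W u r s t).
Proof. by exists u, r, s, t. Qed.

Lemma wiso_refl W : wiso W W.
Proof. by exists 1, 0, 0, 0; rewrite chvar_id oner_neq0. Qed.

Lemma wiso_trans W1 W2 W3 : wiso W1 W2 -> wiso W2 W3 -> wiso W1 W3.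
Proof.
move=> [u [r [s [t [u0 ->]]]]] [u' [r' [s' [t' [u'0 ->]]]]].
by rewrite chvar_comp //; apply: wiso_chvar; rewrite mulf_neq0.
Qed.

Lemma wiso_sym W1 W2 : wiso W1 W2 -> wiso W2 W1.
Proof.
move=> [u [r [s [t [u0 ->]]]]].
exists u^-1, (- r / u ^+ 2), (- s / u), ((s * r - t) / u ^+ 3).
rewrite invr_neq0 // chvar_comp ?invr_neq0 //; split=> //.
by rewrite -[LHS]chvar_id; f_equal; field.
Qed.

Lemma minimal_modelE W W' : minimal_model v W W' <->
  [/\ wiso W W', integral_model v W' & forall W'', wiso W W'' -> integral_model v W'' ->
      v (disc W') <= v (disc W'')].
Proof.
split=> [[WW' [iW' mW']]|[WW' iW' mW']]; split=> //.
  by move=> W'' [u [r [s [t [u0 ->]]]]]; apply: mW'.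
by split=> // u r s t u0; apply: mW'; apply: wiso_chvar.
Qed.

Lemma minimal_model_wiso W1 W2 W' : wiso W1 W2 ->
  minimal_model v W1 W' <-> minimal_model v W2 W'.
Proof.
move=> i12; have i21 := wiso_sym i12; rewrite !minimal_modelE.
split=> -[h1 h2 h3]; split=> //; do ?[exact: wiso_trans h1].
  by move=> W'' h; apply: h3; apply: wiso_trans h.
by move=> W'' h; apply: h3; apply: wiso_trans h.
Qed.

Lemma tamagawa_chvar W u r s t n : u != 0 ->
  tamagawa v (chvar W u r s t) n -> tamagawa v W n.
Proof.
move=> u0; have i := minimal_model_wiso _ (wiso_chvar W r s t u0).
move=> [[W' mW'] h]; split; first by exists W'; apply/i.
by move=> W'' /i; apply: h.
Qed.

Lemma bad_reduction_chvar W u r s t : u != 0 ->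
  bad_reduction v (chvar W u r s t) <-> bad_reduction v W.
Proof.
move=> u0; have i := minimal_model_wiso _ (wiso_chvar W r s t u0).
by split=> -[W' [mW' dW']]; exists W'; split=> //; apply/i.
Qed.

Definition integral_modelP W : reflect
  [/\ vge v (wa1 W) 0, vge v (wa2 W) 0, vge v (wa3 W) 0, vge v (wa4 W) 0 & vge v (wa6 W) 0]
  (integral_model v W).
Proof. exact: and5P. Qed.

Lemma integral_b2 W : integral_model v W -> vge v (b2 W) 0.
Proof. by move/integral_modelP=> [*]; rewrite /b2; vsolve Qp. Qed.

Lemma integral_b4 W : integral_model v W -> vge v (b4 W) 0.
Proof. by move/integral_modelP=> [*]; rewrite /b4; vsolve Qp. Qed.

Lemma integral_b6 W : integral_model v W -> vge v (b6 W) 0.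
Proof. by move/integral_modelP=> [*]; rewrite /b6; vsolve Qp. Qed.

Lemma integral_b8 W : integral_model v W -> vge v (b8 W) 0.
Proof. by move/integral_modelP=> [*]; rewrite /b8; vsolve Qp. Qed.

Lemma integral_c4 W : integral_model v W -> vge v (c4 W) 0.
Proof.
move=> iW; have := integral_b2 iW; have := integral_b4 iW; rewrite /c4 => ? ?.
by vsolve Qp.
Qed.

Lemma integral_disc W : integral_model v W -> vge v (disc W) 0.
Proof.
move=> iW; have := (integral_b2 iW, integral_b4 iW, integral_b6 iW, integral_b8 iW).
by move=> [[[]]]; rewrite discE => *; vsolve Qp.
Qed.

Definition reduced W :=
  [/\ integral_model v W, disc W != 0 & v (disc W) < 12 \/ veq v (c4 W) 0].

Lemma val_disc_chvar W u r s t : u != 0 -> disc W != 0 ->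
  v (disc W) = 12 * v u + v (disc (chvar W u r s t)).
Proof.
move=> u0 d0; have := disc_chvar W r s t u0; set d := disc _ => dE.
have d'0 : d != 0 by apply: contraNneq d0 => d'0; rewrite -dE d'0 mulr0.
have : veq v (u ^+ 12 * d) (12 * v u + v d).
  by apply: (veqM Qp); rewrite ?veq_val //; apply: (veqX Qp); rewrite veq_val.
by rewrite dE veqE => /andP[_ /eqP].
Qed.

(** Under scaling by u the integral quantities [disc] and [c4] of the new model are multiplied by
    u^12 and u^4 to give the old ones, so either alternative of [reduced] forces v u <= 0. *)
Lemma reduced_minimal W : reduced W -> minimal_model v W W.
Proof.
move=> [iW d0 h]; apply/minimal_modelE; split=> // [|W' [u [r [s [t [u0 ->]]]]] iW'].
  exact: wiso_refl.
rewrite (val_disc_chvar r s t u0 d0).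
suff : v u <= 0 by vlia.
case: h => [d12|c4u].
  have := integral_disc iW'; have := val_disc_chvar r s t u0 d0.
  have d'0 : disc (chvar W u r s t) != 0.
    by apply: contraNneq d0 => d'0; rewrite -(disc_chvar W r s t u0) d'0 mulr0.
  by rewrite /vge (negPf d'0) /=; vlia.
have : vge v (u ^+ 4 * c4 (chvar W u r s t)) (4 * v u).
  apply: (vgeMl Qp); last exact: integral_c4.
  by apply: (vgeX Qp); apply/veq_vge/veq_val.
by rewrite c4_chvar //; move: c4u; rewrite veqE /vge => /andP[/negPf-> /eqP->] /=; vlia.
Qed.

(** For a nonintegral x, dividing by x^3 exhibits the unit [c4] as an integral multiple of 1 / x,
    which lies in the maximal ideal. Equations of lower degree are used after multiplication by a
    power of x, whence the zero coefficients at the calls. *)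
Lemma integral_root x c0 c1 c2 c3 c4 :
  vge v c0 0 -> vge v c1 0 -> vge v c2 0 -> vge v c3 0 -> veq v c4 0 ->
  c0 + c1 * x + c2 * x ^+ 2 + c3 * x ^+ 3 + c4 * x ^+ 4 = 0 -> vge v x 0.
Proof.
move=> c0i c1i c2i c3i /andP[_ c4u] e; apply: contraNT c4u => xN.
have x0 : x != 0 by apply: contraNneq xN => ->; apply: vge0.
have z1 : vge v x^-1 1.
  by move: xN; rewrite /vge invr_eq0 (negPf x0) (valV Qp) //=; vlia.
rewrite (_ : c4 = - (c0 * x^-1 ^+ 3 + c1 * x^-1 ^+ 2 + c2 * x^-1 + c3) * x^-1); last first.
  apply: (mulIf (expf_neq0 4 x0)); rewrite -[LHS]subr0 -[X in _ - X]e.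
  by field.
by vsolve Qp.
Qed.

(** Equality of the discriminant valuations makes u a unit. The transformation rules of [b6] and
    [b8] are equations for r with leading coefficients 4 and 3, one of which is a unit at every
    prime; those of a2 and a6 are then monic equations for s and t. *)
Lemma minimal_iso_integral W W' : reduced W -> minimal_model v W W' ->
  exists u r s t, [/\ veq v u 0, vge v r 0, vge v s 0, vge v t 0 & W' = chvar W u r s t].
Proof.
move=> rW; have [iW d0 _] := rW.
move=> /minimal_modelE[[u [r [s [t [u0 W'E]]]]] iW' mW'].
have uu : veq v u 0.
  have := mW' _ (wiso_refl W) iW.
  have [_ _ /(_ _ (wiso_chvar W r s t u0))] := (minimal_modelE W W).1 (reduced_minimal rW).
  rewrite -W'E => /(_ iW'); have := val_disc_chvar r s t u0 d0.
  by rewrite -W'E veqE u0 /=; vlia.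
have [a1i a2i a3i a4i a6i] := integral_modelP _ iW.
have [a1i' a2i' a3i' a4i' a6i'] := integral_modelP _ iW'.
have [b2i b4i b6i b8i] := And4 (integral_b2 iW) (integral_b4 iW) (integral_b6 iW)
  (integral_b8 iW).
have [b6i' b8i'] := (integral_b6 iW', integral_b8 iW').
have ri : vge v r 0.
  have [p3|p3] := eqVneq p 3%N.
    apply: (@integral_root _ 0 (b6 W - u ^+ 6 * b6 W') (2 * b4 W) (b2 W) 4).
    - exact: vge0.
    - by vsolve Qp.
    - by vsolve Qp.
    - by [].
    - by apply: (unit_nat Qp); rewrite p3.
    by rewrite W'E b6_chvar //; ring.
  apply: (@integral_root _ (b8 W - u ^+ 8 * b8 W') (3 * b6 W) (3 * b4 W) (b2 W) 3).
  - by vsolve Qp.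
  - by vsolve Qp.
  - by vsolve Qp.
  - by [].
  - by apply: (unit_nat Qp) => //; rewrite dvdn_prime2.
  by rewrite W'E b8_chvar //; ring.
exists u, r, s, t; split=> //.
  apply: (@integral_root _ 0 0 (u ^+ 2 * wa2 W' - wa2 W - 3 * r) (wa1 W) 1).
  - exact: vge0.
  - exact: vge0.
  - by vsolve Qp.
  - by [].
  - exact: (veq1 Qp).
  by rewrite W'E; case: (W) => * /=; field.
apply: (@integral_root _ 0 0
  (u ^+ 6 * wa6 W' - (wa6 W + r * wa4 W + r ^+ 2 * wa2 W + r ^+ 3)) (wa3 W + r * wa1 W) 1).
- exact: vge0.
- exact: vge0.
- by vsolve Qp.
- by vsolve Qp.
- exact: (veq1 Qp).
by rewrite W'E; case: (W) => * /=; field.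
Qed.

Lemma in_E0_chpt W u r s t P : veq v u 0 -> vge v r 0 -> vge v s 0 -> vge v t 0 ->
  in_E0 v (chvar W u r s t) (chpt u r s t P) = in_E0 v W P.
Proof.
move=> uu ri si ti; have u0 := veq_neq0 uu.
case: W P => a1 a2 a3 a4 a6 [[x y]|] //=; congr (~~ _).
have uX k : veq v (u ^+ k) 0 by have := veqX Qp k uu; rewrite mulr0.
have vd z k N : vge v (z / u ^+ k) N = vge v z N by rewrite (vge_div Qp _ _ (uX k)) addr0.
rewrite !vd (vge_add_r Qp) ?(vgeN Qp) //.
have [xi/=|//] := boolP (vge v x 0).
rewrite (vge_add_r Qp) ?(vgeN Qp) // (vge_add_r Qp); last by vsolve Qp.
case: (vge v y 0) => //=.
rewrite (_ : 2 * _ + _ + _ = (2 * y + a1 * x + a3) / u ^+ 3); last by field.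
rewrite vd; have [yN/=|//] := boolP (vge v (2 * y + a1 * x + a3) 1).
rewrite -(vd (a1 * y - _ - _ - _) 4) -[RHS](vge_add_l Qp (x := s * (2 * y + a1 * x + a3) / u ^+ 4)).
  by congr (vge v _ 1); field.
by rewrite vd; vsolve Qp.
Qed.

Lemma index_E0_chvar W u r s t n : veq v u 0 -> vge v r 0 -> vge v s 0 -> vge v t 0 ->
  index_E0 v W n -> index_E0 v (chvar W u r s t) n.
Proof.
move=> uu ri si ti; have u0 := veq_neq0 uu.
have dE P Q : on_curve W P -> on_curve W Q ->
  in_E0 v (chvar W u r s t) (addp (chvar W u r s t) (chpt u r s t P)
    (negp (chvar W u r s t) (chpt u r s t Q))) = in_E0 v W (addp W P (negp W Q)).
  by move=> oP oQ; rewrite negp_chpt // addp_chpt ?on_curve_negp // in_E0_chpt.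
move=> [l [sl /allP ol dl cl]]; exists (map (chpt u r s t) l).
have nl i : (i < n)%N -> nth None [seq chpt u r s t i | i <- l] i = chpt u r s t (nth None l i).
  by move=> ni; rewrite (nth_map None) ?sl.
have onl i : (i < n)%N -> on_curve W (nth None l i).
  by move=> ni; apply: ol; apply: mem_nth; rewrite sl.
split; first by rewrite size_map.
- by apply/allP => _ /mapP[P Pl ->]; rewrite on_curve_chpt //; apply: ol.
- by move=> i j ni nj ij; rewrite !nl // dE ?onl //; apply: dl.
- move=> P' /(chptK u0)[P oP ->]; have [i ni h] := cl P oP.
  by exists i => //; rewrite nl // dE ?onl.
Qed.

Lemma tamagawa_reduced W n : reduced W -> index_E0 v W n -> tamagawa v W n.
Proof.
move=> rW iW; split; first by exists W; apply: reduced_minimal.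
move=> W' /(minimal_iso_integral rW)[u [r [s [t [uu ri si ti ->]]]]].
exact: index_E0_chvar.
Qed.

Lemma bad_reduction_reduced W : reduced W -> bad_reduction v W <-> vge v (disc W) 1.
Proof.
move=> rW; split=> [[W' []]|dW]; last by exists W; split=> //; apply: reduced_minimal.
move=> /(minimal_iso_integral rW)[u [r [s [t [uu _ _ _ ->]]]]] dW'.
rewrite -(disc_chvar W r s t (veq_neq0 uu)); apply: (vgeMr Qp) => //.
by vsolve Qp.
Qed.

End MinimalModels.

(** * Split multiplicative reduction *)

Section ComponentGroups.
Variables (p : nat) (K : fieldType) (v : K -> int).
Hypotheses (pp : prime p) (Qp : Qp_field p v).
Implicit Types (W : weier K) (u r s t x y : K) (P : point K).

(** Placing the singular point of the reduction at the origin turns failure of [in_E0] into the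
    divisibility of both coordinates by p. *)
Definition singular_at_origin W :=
  [/\ integral_model v W, vge v (wa3 W) 1, vge v (wa4 W) 1 & vge v (wa6 W) 1].

Lemma notin_E0 W x y : singular_at_origin W -> vge v x 1 -> vge v y 1 ->
  ~~ in_E0 v W (Some (x, y)).
Proof.
case: W => a1 a2 a3 a4 a6 [] /integral_modelP[/= a1i a2i _ _ _] a3i a4i a6i x1 y1.
by rewrite negbK; apply/and4P; split; vsolve Qp.
Qed.

Lemma in_E0P W x y : singular_at_origin W -> on_curve W (Some (x, y)) ->
  in_E0 v W (Some (x, y)) = ~~ (vge v x 1 && vge v y 1).
Proof.
move=> sW oP; have [/andP[x1 y1]|/=] := boolP (vge v x 1 && vge v y 1).
  exact/negbTE/notin_E0.
apply: contraNT; case: W sW oP => a1 a2 a3 a4 a6.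
move=> [] /integral_modelP[/= a1i a2i _ _ _] a3i a4i a6i /eqP e.
rewrite negbK => /and4P[xi yi F1 F2].
have x1 : vge v x 1.
  apply: (vge_cube Qp).
  (* With F the defining polynomial, 2 F - x F_x - y F_y equals x^3 up to terms in a3, a4, a6. The
     coefficient 1 makes this valid at 2 and 3 too. *)
  rewrite (_ : x ^+ 3 = - (y * (2 * y + a1 * x + a3)
    + x * (a1 * y - 3 * x ^+ 2 - 2 * a2 * x - a4)) - a3 * y + a4 * x + 2 * a6).
    by vsolve Qp.
  have -> : a6 = y ^+ 2 + a1 * x * y + a3 * y - (x ^+ 3 + a2 * x ^+ 2 + a4 * x).
    by rewrite e; ring.
  by ring.
rewrite x1; apply: (vge_sqr Qp).
rewrite (_ : y ^+ 2 = x ^+ 3 + a2 * x ^+ 2 + a4 * x + a6 - a1 * x * y - a3 * y).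
  by vsolve Qp.
by rewrite -e; ring.
Qed.

(** Finite choice by induction; it collects one representative per component into a list. *)
Lemma seq_choice (T : Type) (d : T) (R : nat -> T -> Prop) n :
  (forall i, (i < n)%N -> exists z, R i z) ->
  exists2 s, size s = n & forall i, (i < n)%N -> R i (nth d s i).
Proof.
elim: n => [|n IHn] h; first by exists [::].
have [i ni|s sn hs] := IHn; first by apply: h; apply: ltnW.
have [z hz] := h n (ltnSn n).
exists (rcons s z) => [|i]; first by rewrite size_rcons sn.
rewrite ltnS leq_eqVlt nth_rcons sn => /orP[/eqP->|ni]; first by rewrite ltnn eqxx.
by rewrite ni; apply: hs.
Qed.

Lemma in_E0_0 W : in_E0 v W None.
Proof. by case: W. Qed.

Lemma in_E0_neg W P : singular_at_origin W -> on_curve W P -> in_E0 v W (negp W P) = in_E0 v W P.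
Proof.
move=> sW oP; have oN := on_curve_negp oP; case: P oP oN => [[x y]|]; last by rewrite negp0.
move=> oP; rewrite negpE => oN; rewrite !in_E0P //.
have [/integral_modelP[a1i _ _ _ _] a3i _ _] := sW.
congr (~~ _); have [x1|//] /= := boolP (vge v x 1).
by rewrite (vge_add_r Qp) ?(vgeN Qp) // (vge_add_r Qp) ?(vgeN Qp) //; vsolve Qp.
Qed.

(* With [x = u (u + 1)], the two branches of the node [y^2 + x y = x^3] are [y = u^2 (u + 1)] and
   [y = - u (u + 1)^2]; a point of [y^2 + x y = x^3 + c] near the node deviates from them
   by [A] and [B] with [A B = c], and [v A] is its component. *)
Definition split_component (c : K) (i : int) P := exists u A B,
  [/\ vge v u 1, veq v A i, A * B = c, B = A + u * (u + 1) * (2 * u + 1) &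
      P = Some (u * (u + 1), A + u ^+ 2 * (u + 1))].

Definition split_curve (c : K) : weier K := Weier 1 0 0 0 c.

Section Split.
Variables (c : K) (N : int).
Hypotheses (N0 : 0 < N) (cN : veq v c N).

Let W := split_curve c.

Let c1 : vge v c 1. Proof. by apply: (vgeW _ (veq_vge cN)); vlia. Qed.

Lemma split_singular : singular_at_origin W.
Proof.
split; do ?exact: vge0; last exact: c1.
apply/integral_modelP; split; do ?exact: vge0; first exact: (vge1 Qp).
by apply: vgeW c1.
Qed.

Lemma split_component_curve i P : split_component c i P -> on_curve W P.
Proof.
move=> [u [A [B [_ _ AB BE ->]]]]; apply/eqP; rewrite -AB BE; ring.
Qed.

Lemma split_component_notin i P : split_component c i P -> 0 < i -> ~~ in_E0 v W P.
Proof.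
move=> [u [A [B [u1 Ai _ _ ->]]]] i0; have A1 : vge v A 1 by apply: (vgeW _ (veq_vge Ai)); vlia.
by apply: (notin_E0 split_singular); vsolve Qp.
Qed.

(** With A = p^i and B = c / A, the condition on B is 2 u^3 + 3 u^2 + u = B - A, whose linear
    coefficient is 1. *)
Lemma split_component_exists i : 0 < i < N -> exists P, split_component c i P.
Proof.
move=> iN.
have [A Ai] : exists A, veq v A i by exists (p%:R ^ i); apply: (veq_pz Qp pp).
have A0 := veq_neq0 Ai.
have Bi : veq v (c / A) (N - i) by rewrite (veq_div Qp _ _ Ai) subrK.
have A1 : vge v A 1 by apply: (vgeW _ (veq_vge Ai)); vlia.
have B1 : vge v (c / A) 1 by apply: (vgeW _ (veq_vge Bi)); vlia.
have [u u1 uE] : exists2 u, vge v u 1 &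
    (A - c / A) + 1 * u + 3 * u ^+ 2 + 2 * u ^+ 3 = 0.
  apply: (hensel_cubic Qp); rewrite ?(vge_nat Qp) ?(veq1 Qp) //.
  by apply: (vgeB Qp).
exists (Some (u * (u + 1), A + u ^+ 2 * (u + 1))), u, A, (c / A); split=> //.
  by rewrite mulrC divfK.
by rewrite -[LHS]addr0 -uE; ring.
Qed.

Lemma split_component_of x y : on_curve W (Some (x, y)) -> vge v x 1 -> vge v y 1 ->
  exists2 i, 0 < i < N & split_component c i (Some (x, y)).
Proof.
move=> /eqP /= e x1 y1.
have c_neq0 := veq_neq0 cN.
have [u u1 uE] : exists2 u, vge v u 1 & - x + 1 * u + 1 * u ^+ 2 + 0 * u ^+ 3 = 0.
  apply: (hensel_cubic Qp); rewrite ?(vgeN Qp) ?(vge1 Qp) ?vge0 //; exact: (veq1 Qp).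
have xE : x = u * (u + 1) by rewrite -[LHS]addr0 -uE; ring.
(* The deviations from the two branches multiply to y^2 + x y - x^3 = c, so their positive
   valuations sum to [N]. *)
pose A := y - u ^+ 2 * (u + 1); pose B := y + u * (u + 1) ^+ 2.
have ABc : A * B = c.
  rewrite (_ : c = y ^+ 2 + 1 * x * y + 0 * y - (x ^+ 3 + 0 * x ^+ 2 + 0 * x)).
    by rewrite /A /B xE; ring.
  by rewrite e; ring.
have A1 : vge v A 1 by rewrite /A; vsolve Qp.
have B1 : vge v B 1 by rewrite /B; vsolve Qp.
have /andP[A0 B0] : (A != 0) && (B != 0) by rewrite -negb_or -mulf_eq0 ABc.
exists (v A).
  move: cN A1 B1; rewrite -ABc veqE /vge (negPf A0) (negPf B0) /= (val_mul Qp) //.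
  by move=> /andP[_ /eqP]; vlia.
exists u, A, B; split=> //; first exact: veq_val.
  by rewrite /A /B; ring.
by rewrite -xE; congr (Some (_, _)); rewrite /A; ring.
Qed.

(** Negation exchanges the branches: (A, B) becomes (- B, - A), and v B = N - v A. *)
Lemma split_component_neg i P : split_component c i P -> split_component c (N - i) (negp W P).
Proof.
move=> [u [A [B [u1 Ai AB BE ->]]]]; exists u, (- B), (- A); split=> //.
- rewrite (veqN Qp) (_ : B = c / A) ?(veq_div Qp _ _ Ai) ?subrK //.
  by rewrite -AB mulrC mulKf ?(veq_neq0 Ai).
- by rewrite mulrNN mulrC.
- by rewrite BE; ring.
- by congr (Some (_, _)); rewrite BE; ring.
Qed.

Lemma split_component_add i j P Q : split_component c i P -> split_component c j Q ->
  0 < i -> 0 < j ->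
  in_E0 v W (addp W P Q) = (i + j == N).
Proof.
move=> cP cQ i0 j0; have oP := split_component_curve cP; have oQ := split_component_curve cQ.
have oPQ := on_curve_addp oP oQ.
case: cP cQ oP oQ oPQ => [u1 [A1 [B1 [u1s A1i AB1 B1E ->]]]].
move=> [u2 [A2 [B2 [u2s A2j AB2 B2E ->]]]].
set x1 := u1 * _; set y1 := A1 + _; set x2 := u2 * _; set y2 := A2 + _ => oP oQ oPQ.
have [A10 A20] := (veq_neq0 A1i, veq_neq0 A2j).
have A1s : vge v A1 1 by apply: (vgeW _ (veq_vge A1i)); vlia.
have A2s : vge v A2 1 by apply: (vgeW _ (veq_vge A2j)); vlia.
have x1s : vge v x1 1 by rewrite /x1; vsolve Qp.
have x2s : vge v x2 1 by rewrite /x2; vsolve Qp.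
have y1s : vge v y1 1 by rewrite /y1; vsolve Qp.
have unit1 z : vge v z 1 -> veq v (1 + z) 0 by move=> zs; apply: (veqD Qp (veq1 Qp)).
(* [s], [S] and [Z] are the difference quotients in u of u (u + 1), u^2 (u + 1) and u (u + 1) (2 u +
   1); only [S] vanishes modulo p, the other two being 1 there. *)
pose s := 1 + (u1 + u2).
pose S := u1 ^+ 2 + u1 * u2 + u2 ^+ 2 + u1 + u2.
pose Z := 1 + (2 * (u1 ^+ 2 + u1 * u2 + u2 ^+ 2) + 3 * (u1 + u2)).
have su : veq v s 0 by apply: unit1; vsolve Qp.
have Ss : vge v S 1 by rewrite /S; vsolve Qp.
have Zu : veq v Z 0 by apply: unit1; vsolve Qp.
have AA := veqM Qp A1i A2j.
have [[x12 [-> yE]]|[l [l1 l2 PQE]]] := addp_slope oP oQ.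
  rewrite in_E0_0; apply/esym/eqP; move: yE; rewrite /= => yE.
  have u12 : u1 = u2.
    have : (u1 - u2) * s = 0.
      transitivity (x1 - x2); first by rewrite /s /x1 /x2; ring.
      by rewrite x12 subrr.
    by move/eqP; rewrite mulf_eq0 (negPf (veq_neq0 su)) orbF subr_eq0 => /eqP.
  have AB : A1 = - B2.
    apply/eqP; rewrite -addr_eq0 -yE B2E /x2 /y1 /y2 u12; apply/eqP; ring.
  by apply: (veq_uniq AA); rewrite AB mulNr (veqN Qp) mulrC AB2.
(* This is the exact form, free of denominators, of the congruence for the slope. When u1 and u2
   differ, [l * s - S] is (A1 - A2) / (u1 - u2). *)
have main : (l * s - S) * (c + A1 * A2) = - Z * (A1 * A2).
  move: l1 l2; rewrite /= => l1 l2.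
  have h1 : (l * s - S) * (u1 - u2) = A1 - A2.
    rewrite mulrBl -mulrA (_ : s * (u1 - u2) = x1 - x2); last by rewrite /s /x1 /x2; ring.
    by rewrite l1 /y1 /y2 /S; ring.
  have h2 : (u1 - u2) * Z = (B1 - B2) - (A1 - A2) by rewrite B1E B2E /Z; ring.
  have h3 : A1 * A2 * (B1 - B2) = c * (A2 - A1).
    transitivity (A2 * (A1 * B1) - A1 * (A2 * B2)); first by ring.
    by rewrite AB1 AB2; ring.
  (* If A1 = A2, then u1 = u2 as well, so the points coincide and only the tangent equation [l2]
     carries information. *)
  have [A12|A12] := eqVneq A1 A2; last first.
    have A12' : A1 - A2 != 0 by rewrite subr_eq0.
    apply: (mulfI A12').
    transitivity ((l * s - S) * ((A1 - A2) * c + (A1 - A2) * (A1 * A2))); first by ring.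
    have -> : (A1 - A2) * c + (A1 - A2) * (A1 * A2) = - (A1 * A2) * (u1 - u2) * Z.
      by rewrite -mulrA h2 mulrBr mulNr h3; ring.
    by rewrite -h1; ring.
  have u12 : u1 = u2.
    have : (u1 - u2) * Z = 0.
      apply: (mulfI A10); apply: (mulfI A20); rewrite mulr0 mulr0.
      transitivity (A1 * A2 * (B1 - B2) - A1 * A2 * (A1 - A2)).
        by rewrite h2; ring.
      by rewrite h3 A12; ring.
    by move/eqP; rewrite mulf_eq0 (negPf (veq_neq0 Zu)) orbF subr_eq0 => /eqP.
  have -> : c + A1 * A2 = (B1 + A1) * A1 by rewrite -AB1 -A12; ring.
  rewrite -A12 mulrA mulrA; congr (_ * _).
  transitivity (s * (l * (y1 + y2 + 1 * x1 + 0)) - S * (B1 + A1)).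
    by rewrite B1E /y1 /y2 /x1 -A12 -u12; ring.
  by rewrite l2 B1E /s /S /Z /y2 /x1 /x2 -A12 -u12; ring.
rewrite PQE in oPQ *; set x3 := (X in Some (X, _)) in oPQ *.
set y3 := (X in Some (_, X)) in oPQ *.
have x3E : x3 = l * (l + 1) - x1 - x2 by rewrite /x3 /=; ring.
have y3E : y3 = - (l + 1) * x3 - (y1 - l * x1) by rewrite x3E /y3 /=; ring.
have notin : vge v l 0 -> vge v (l * (l + 1)) 1 -> ~~ in_E0 v W (Some (x3, y3)).
  move=> li ls; have x3s : vge v x3 1 by rewrite x3E; vsolve Qp.
  by apply: (notin_E0 split_singular) => //; rewrite y3E; vsolve Qp.
(* For i + j < N the constant [c] is negligible beside A1 A2 and l is -1 modulo p; for i + j > N it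
   dominates and l is 0. Either way x3, which is l (l + 1) modulo p, vanishes there. *)
have [ijN|Nij|ijN] := ltgtP (i + j) N; rewrite ?ijN ?eqxx.
- pose e := c / (A1 * A2).
  have es : vge v e 1 by rewrite (vge_div Qp _ _ AA); apply: (vgeW _ (veq_vge cN)); vlia.
  have l1s : vge v (l + 1) 1.
    have u := veqM Qp su (unit1 _ es); rewrite -(vge_mul_veq Qp _ _ u) add0r.
    have -> : s * (1 + e) * (l + 1) = (s * (1 + e) + S * (1 + e)) + (l * s - S) * (1 + e) by ring.
    have -> : (l * s - S) * (1 + e) = - Z.
      apply: (mulIf (veq_neq0 AA)); rewrite -main -mulrA; congr (_ * _).
      by rewrite /e; field; rewrite A10 A20.
    rewrite /s /Z (_ : _ - _ = (u1 + u2) + (1 + (u1 + u2)) * e + S * (1 + e)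
      - (2 * (u1 ^+ 2 + u1 * u2 + u2 ^+ 2) + 3 * (u1 + u2))); last by ring.
    by vsolve Qp.
  have li : vge v l 0.
    by rewrite (_ : l = (l + 1) - 1); [vsolve Qp | ring].
  by apply/negbTE/notin => //; vsolve Qp.
- pose e := A1 * A2 / c.
  have es : vge v e 1 by rewrite (vge_div Qp _ _ cN); apply: (vgeW _ (veq_vge AA)); vlia.
  have ls : vge v l 1.
    have u := veqM Qp su (unit1 _ es); rewrite -(vge_mul_veq Qp _ _ u) add0r.
    have -> : s * (1 + e) * l = S * (1 + e) + (l * s - S) * (1 + e) by ring.
    have -> : (l * s - S) * (1 + e) = - Z * e.
      have ec : e * c = A1 * A2 by rewrite divfK // (veq_neq0 cN).
      apply: (mulIf (veq_neq0 cN)).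
      transitivity ((l * s - S) * (c + e * c)); first by ring.
      by rewrite ec main -ec; ring.
    by vsolve Qp.
  by apply/negbTE/notin => //; vsolve Qp.
- rewrite (in_E0P split_singular oPQ); apply/negP => /andP[x3s _].
  have ls : vge v (l * (l + 1)) 1.
    rewrite (_ : l * (l + 1) = x3 + x1 + x2); last by rewrite x3E; ring.
    by vsolve Qp.
  have AAs := veq_vge AA.
  have cs := veq_vge cN.
  (* When i + j = N, both residues 0 and -1 of l are excluded by [main]: each puts a term of
     valuation exactly [N] equal to one of valuation above [N]. *)
  have [l0|l1'] := @vge_mul_split _ _ _ Qp _ _ 1 ls.
    have /andP[_ /negP[]] : veq v (- Z * (A1 * A2)) N.
      by rewrite -ijN -[i + j]add0r; apply: (veqM Qp); rewrite ?(veqN Qp).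
    rewrite -main [N + 1]addrC; apply: (vgeM Qp); first by vsolve Qp.
    by apply: (vgeD Qp) => //; rewrite -ijN.
  have h : ((l + 1) * s - S) * c - s * c = ((S - (l + 1) * s) + (s - Z)) * (A1 * A2).
    transitivity ((l * s - S) * (c + A1 * A2) - (l * s - S) * (A1 * A2)); first by ring.
    by rewrite main; ring.
  have /andP[_ /negP[]] : veq v (((l + 1) * s - S) * c - s * c) N.
    rewrite addrC -mulNr -mulrDl -[N]add0r; apply: (veqM Qp) => //.
    by apply: (veqD Qp); rewrite ?(veqN Qp) // add0r; vsolve Qp.
  rewrite h [N + 1]addrC -ijN; apply: (vgeM Qp) => //.
  have sZ : vge v (s - Z) 1.
    rewrite /s /Z (_ : _ - _ = u1 + u2 - (2 * (u1 ^+ 2 + u1 * u2 + u2 ^+ 2)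
      + 3 * (u1 + u2))); last by ring.
    by vsolve Qp.
  by vsolve Qp.
Qed.

End Split.

End ComponentGroups.

(** * Counting components at a node *)

Section ComponentCounts.
Variables (p : nat) (K : fieldType) (v : K -> int).
Hypotheses (pp : prime p) (Qp : Qp_field p v).
Implicit Types (W : weier K) (u r s t x y : K) (P : point K).

Lemma index_split c (n : nat) : (0 < n)%N -> veq v c n -> index_E0 v (split_curve c) n.
Proof.
move=> n0 cn; set W := split_curve c; have n0' : 0 < n%:Z by vlia.
have sW : singular_at_origin v W by apply: (split_singular Qp n0' cn).
(* The class of E_0 is represented by O; the parametrization near the node is used only for the
   other classes. *)
pose R i P := if i is 0%N then P = None else split_component v c i%:Z P.
have [i ni|l ln Rl] := @seq_choice _ None R n.
  case: i ni => [|i] ni; first by exists None.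
  by apply: (split_component_exists pp Qp n0' cn); vlia.
have Rc i P : R i P -> on_curve W P.
  by case: i => [->|i] //; apply: split_component_curve.
have RnE0 i P : (i < n)%N -> R i P -> (i == 0)%N = in_E0 v W P.
  case: i => [|i] ni; first by move=> ->; rewrite in_E0_0.
  by move=> RP; apply/esym/negbTE/(split_component_notin Qp n0' cn RP).
have RB i j P Q : (i < n)%N -> (j < n)%N -> R i P -> R j Q ->
    in_E0 v W (addp W P (negp W Q)) = (i == j).
  case: i j => [|i] [|j] ni nj RP RQ.
  - by rewrite RP RQ negp0 addp0 in_E0_0.
  - by rewrite RP add0p (in_E0_neg Qp) ?(Rc j.+1) // -(RnE0 j.+1).
  - by rewrite RQ negp0 addp0 -(RnE0 i.+1).
  rewrite (split_component_add Qp n0' cn RP (split_component_neg Qp cn RQ)); vlia.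
exists l; split=> //.
- apply/allP => P /(nthP None)[i]; rewrite ln => ni <-; exact: Rc (Rl i ni).
- by move=> i j ni nj ij; rewrite (RB i j _ _ ni nj (Rl i ni) (Rl j nj)); apply/eqP.
- move=> P oP; have [PE|PE] := boolP (in_E0 v W P).
    by exists 0%N => //; rewrite (Rl 0%N n0) negp0 addp0.
  case: P oP PE => [[x y]|] oP; last by rewrite in_E0_0.
  rewrite (in_E0P Qp sW oP) negbK => /andP[x1 y1].
  have [[i|//] iN] := split_component_of Qp n0' cn oP x1 y1.
  case: i iN => [|i] iN ci; first vlia.
  have ni : (i.+1 < n)%N by vlia.
  by exists i.+1 => //; rewrite (RB i.+1 i.+1 _ _ ni ni ci (Rl _ ni)) eqxx.
Qed.

Definition node_curve a1 a2 c : weier K := Weier a1 a2 0 0 c.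

(** The roots of this quadratic modulo p are the slopes of the tangents at the node, so the tangents
    are irrational, in a form valid at 2. *)
Definition anisotropic a1 a2 := forall l, vge v l 0 -> veq v (l ^+ 2 + a1 * l - a2) 0.

(** The form is the norm form of the unramified quadratic extension, so its valuation is twice the
    minimum [M] of those of x and y. The last clause expresses maximality of [M] while allowing one
    coordinate to be zero. *)
Lemma anisotropic_val a1 a2 x y : vge v a1 0 -> vge v a2 0 -> anisotropic a1 a2 ->
  (x != 0) || (y != 0) ->
  exists M, [/\ veq v (y ^+ 2 + a1 * x * y - a2 * x ^+ 2) (2 * M), vge v x M, vge v y M &
    forall j, vge v x j -> vge v y j -> j <= M].
Proof.
move=> a1i a2i an xy0.
have [x0|x0] := eqVneq x 0.
  move: xy0; rewrite x0 eqxx /= => y0; exists (v y).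
  split; [|exact: vge0|exact/veq_vge/veq_val|by move=> j _; rewrite /vge (negPf y0)].
  rewrite (_ : _ - _ = y ^+ 2); last by ring.
  by apply: (veqX Qp 2); apply: veq_val.
have [li|lN] := boolP (vge v (y / x) 0).
  exists (v x); have xx := veq_val v x0; split.
  - rewrite (_ : _ - _ = x ^+ 2 * ((y / x) ^+ 2 + a1 * (y / x) - a2)); last by field.
    by rewrite -[2 * v x]addr0; apply: (veqM Qp); [apply: (veqX Qp 2) | apply: an].
  - exact: veq_vge.
  - by move: li; rewrite (vge_div Qp _ _ xx) add0r.
  - by move=> j; rewrite /vge (negPf x0).
have y0 : y != 0 by apply: contraNneq lN => ->; rewrite mul0r vge0.
have yy := veq_val v y0.
have k1 : vge v (x / y) 1.
  move: lN; rewrite (vge_div Qp _ _ yy) (vge_div Qp _ _ (veq_val v x0)) /vge.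
  by rewrite (negPf x0) (negPf y0) /=; vlia.
exists (v y); split.
- rewrite (_ : _ - _ = y ^+ 2 * (1 + (a1 * (x / y) - a2 * (x / y) ^+ 2))); last by field.
  rewrite -[2 * v y]addr0; apply: (veqM Qp); first exact: (veqX Qp 2).
  by apply: (veqD Qp (veq1 Qp)); vsolve Qp.
- by move: k1; rewrite (vge_div Qp _ _ yy); apply: vgeW; vlia.
- exact: veq_vge.
- by move=> j _; rewrite /vge (negPf y0).
Qed.

Section Nonsplit.
Variables (a1 a2 c : K) (N : int).
Hypotheses (a1i : vge v a1 0) (a2i : vge v a2 0) (an : anisotropic a1 a2).
Hypotheses (N0 : 0 < N) (cN : veq v c N).

Let W := node_curve a1 a2 c.

Lemma nonsplit_singular : singular_at_origin v W.
Proof.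
have c1 : vge v c 1 by apply: (vgeW _ (veq_vge cN)); vlia.
split; rewrite ?vge0 //; apply/integral_modelP; split; rewrite ?vge0 //.
exact: vgeW c1.
Qed.

(** If the sum reduced to the node too, x3 = l^2 + a1 l - a2 - x1 - x2 would make the slope l a
    rational tangent direction modulo p. *)
Lemma nonsplit_add P Q : on_curve W P -> on_curve W Q -> ~~ in_E0 v W P -> ~~ in_E0 v W Q ->
  in_E0 v W (addp W P Q).
Proof.
case: P Q => [[x1 y1]|] [[x2 y2]|]; rewrite ?in_E0_0 // => oP oQ.
rewrite !(in_E0P Qp nonsplit_singular) // !negbK => /andP[x1s y1s] /andP[x2s y2s].
have oPQ := on_curve_addp oP oQ.
have [[_ [-> _]]|[l [_ _ E]]] := addp_slope oP oQ; first by rewrite in_E0_0.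
rewrite E in oPQ *; rewrite (in_E0P Qp nonsplit_singular oPQ); apply/negP => /andP[x3s _].
have l1 : vge v (l ^+ 2 + a1 * l - a2) 1.
  set x3 := (X in vge v X 1) in x3s.
  rewrite (_ : _ - _ = x3 + x1 + x2); last by rewrite /x3 /=; ring.
  by vsolve Qp.
have li : vge v l 0.
  apply: (@integral_root p K v Qp l 0 0 (- (l ^+ 2 + a1 * l)) a1 1);
    rewrite ?vge0 ?(veq1 Qp) //; last by ring.
  rewrite (_ : l ^+ 2 + a1 * l = (l ^+ 2 + a1 * l - a2) + a2); last by ring.
  by vsolve Qp.
by have /andP[_] := an li; rewrite add0r l1.
Qed.

(** Since M >= 1, the cubic term has valuation at least 3 M > 2 M, so c has the valuation of the
    quadratic form. *)
Lemma nonsplit_val x y : on_curve W (Some (x, y)) -> vge v x 1 -> vge v y 1 ->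
  exists M, N = 2 * M.
Proof.
move=> /eqP /= e x1 y1.
have cE : c = y ^+ 2 + a1 * x * y - a2 * x ^+ 2 - x ^+ 3.
  rewrite (_ : y ^+ 2 + a1 * x * y = y ^+ 2 + a1 * x * y + 0 * y); last by ring.
  by rewrite e; ring.
have xy0 : (x != 0) || (y != 0).
  rewrite -negb_and; apply: contraNN (veq_neq0 cN) => /andP[/eqP x0 /eqP y0].
  by rewrite cE x0 y0; apply/eqP; ring.
have [M [QM xM yM jM]] := anisotropic_val a1i a2i an xy0.
have M1 := jM 1 x1 y1.
exists M; apply: (veq_uniq cN); rewrite cE; apply: (veqD Qp QM); rewrite (vgeN Qp).
by apply: (vgeW _ (vgeX Qp 3 xM)); vlia.
Qed.

Lemma index_nonsplit_odd : (forall M, N <> 2 * M) -> index_E0 v W 1.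
Proof.
move=> Nodd; exists [:: None]; split=> //.
  by move=> [|//] [|//].
move=> P oP; exists 0%N => //; rewrite negp0 addp0.
case: P oP => [[x y]|] oP; last exact: in_E0_0.
rewrite (in_E0P Qp nonsplit_singular oP); apply/negP => /andP[x1 y1].
by have [M] := nonsplit_val oP x1 y1; apply: Nodd.
Qed.

Lemma index_two_components P0 : on_curve W P0 -> ~~ in_E0 v W P0 -> index_E0 v W 2.
Proof.
move=> oP0 nP0; have sW := nonsplit_singular.
exists [:: None; P0]; split=> //; first by apply/andP; split=> //; apply/andP.
  move=> [|[|//]] [|[|//]] // _ _ _; first by rewrite add0p (in_E0_neg Qp).
  by rewrite negp0 addp0.
move=> P oP; have [PE|PE] := boolP (in_E0 v W P).
  by exists 0%N => //; rewrite negp0 addp0.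
exists 1%N => //; apply: nonsplit_add => //; first exact: on_curve_negp.
by rewrite (in_E0_neg Qp).
Qed.

End Nonsplit.

(** Dividing both coordinates by q = p^M turns the curve into a conic modulo p with unit constant c
    / q^2. Such a conic is smooth, so a residual point lifts along y or along x. *)
Lemma node_point_lift a1 a2 c (M : int) : vge v a1 0 -> vge v a2 0 ->
  veq v (a1 ^+ 2 + 4 * a2) 0 -> 0 < M -> veq v c (2 * M) ->
  (exists x y, [/\ vge v x 0, vge v y 0 &
     vge v (y ^+ 2 + a1 * x * y - a2 * x ^+ 2 - c / (p%:R ^ M) ^+ 2) 1]) ->
  exists x y, [/\ on_curve (node_curve a1 a2 c) (Some (x, y)), vge v x 1 & vge v y 1].
Proof.
move=> a1i a2i b2u M0 cM [x [y [xi yi h]]].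
have qM := veq_pz Qp pp M; set q := p%:R ^ M in h qM.
have q0 := veq_neq0 qM.
have q1 : vge v q 1 by apply: (vgeW _ (veq_vge qM)); vlia.
suff [X [Y [Xi Yi XY]]] : exists X Y, [/\ vge v X 0, vge v Y 0 &
    Y ^+ 2 + a1 * X * Y - a2 * X ^+ 2 - q * X ^+ 3 - c / q ^+ 2 = 0].
  exists (q * X), (q * Y); split; try by vsolve Qp.
  apply/eqP/subr0_eq; rewrite -[RHS](mulr0 (q ^+ 2)) -[in RHS]XY.
  by field.
have f0 : vge v (y ^+ 2 + a1 * x * y - a2 * x ^+ 2 - q * x ^+ 3 - c / q ^+ 2) 1.
  set z := y ^+ 2 + _ - _ in h *.
  rewrite (_ : _ - _ = (z - c / q ^+ 2) - q * x ^+ 3); last by ring.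
  by vsolve Qp.
have unitP z : vge v z 0 -> ~~ vge v z 1 -> veq v z 0 by move=> zi z1; apply/andP.
have [F1|/unitP F1] := boolP (vge v (2 * y + a1 * x) 1); last first.
  have [|z zs zE] := hensel_cubic Qp f0 (F1 _) (vge1 Qp) (vge0 v 0); try by vsolve Qp.
  exists x, (y + z); split=> //; first by vsolve Qp.
  by rewrite -zE; ring.
have F2 : veq v (a1 * y - 2 * a2 * x - 3 * q * x ^+ 2) 0.
  apply: unitP; first by vsolve Qp.
  (* Both derivatives vanishing is a linear system in (x, y) with determinant [b2] up to sign; it
     forces the residual point to be the origin, which the unit c / q^2 forbids. *)
  apply/negP => F2.
  have F3 : vge v (a1 * y - 2 * a2 * x) 1.
    rewrite (_ : _ - _ = (a1 * y - 2 * a2 * x - 3 * q * x ^+ 2) + 3 * q * x ^+ 2); last by ring.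
    by vsolve Qp.
  have x1 : vge v x 1.
    rewrite -(vge_mul_veq Qp _ _ b2u) add0r.
    rewrite (_ : _ * x = a1 * (2 * y + a1 * x) - 2 * (a1 * y - 2 * a2 * x)); last by ring.
    by vsolve Qp.
  have y1 : vge v y 1.
    rewrite -(vge_mul_veq Qp _ _ b2u) add0r.
    rewrite (_ : _ * y = 2 * a2 * (2 * y + a1 * x) + a1 * (a1 * y - 2 * a2 * x)); last by ring.
    by vsolve Qp.
  have /andP[_ /negP[]] : veq v (c / q ^+ 2) 0.
    by rewrite (veq_div Qp _ _ (veqX Qp 2 qM)) add0r.
  rewrite add0r (_ : c / q ^+ 2 = (y ^+ 2 + a1 * x * y - a2 * x ^+ 2)
    - (y ^+ 2 + a1 * x * y - a2 * x ^+ 2 - c / q ^+ 2)); last by ring.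
  by vsolve Qp.
have [||z zs zE] := @hensel_cubic _ _ _ Qp _ _ (- a2 - 3 * q * x) (- q) f0 F2.
- by vsolve Qp.
- by vsolve Qp.
exists (x + z), y; split=> //; first by vsolve Qp.
by rewrite -zE; ring.
Qed.

End ComponentCounts.

(** * Squares modulo an odd prime *)

Lemma sqr_mod_inj (p i j : nat) : prime p -> (i.*2 < p)%N -> (j.*2 < p)%N ->
  i ^ 2 = j ^ 2 %[mod p] -> i = j.
Proof.
move=> pp; wlog ji : i j / (j <= i)%N.
  move=> h ip jp ij; have [|/ltnW] := leqP j i => [ji|ij']; first exact: h.
  by apply/esym/h.
move=> ip jp /eqP; rewrite eqn_mod_dvd ?leq_exp2r // subn_sqr Euclid_dvdM //.
case/orP => /dvdn_leq h; apply/eqP; rewrite eqn_leq ji andbT leqNgt; apply/negP => lij.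
  by have := h ltac:(lia); lia.
by have := h ltac:(lia); lia.
Qed.

(* Pigeonhole: there are [(p + 1) / 2] squares and as many values [E + D j ^ 2] modulo [p]. *)
Lemma square_affine_square_mod (p D E : nat) : prime p -> odd p -> ~~ (p %| D)%N ->
  exists i j : nat, i ^ 2 = E + D * j ^ 2 %[mod p].
Proof.
move=> pp op pD; have p0 := prime_gt0 pp.
have ph : p = (p./2).*2.+1 by lia.
pose f (z : 'I_(p./2).+1 + 'I_(p./2).+1) : 'I_p := match z with
  | inl i => Ordinal (ltn_pmod (i ^ 2) p0)
  | inr j => Ordinal (ltn_pmod (E + D * j ^ 2) p0) end.
have h2 (i : 'I_(p./2).+1) : ((i : nat).*2 < p)%N by have := ltn_ord i; lia.
have [|finj] := altP (injectiveP f); last first.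
  case/injectivePn: finj => -[i|i] [[j|j] ij /(congr1 val) /= fij].
  - by case/eqP: ij; f_equal; apply/val_inj; apply: (sqr_mod_inj pp (h2 i) (h2 j) fij).
  - by exists i, j.
  - by exists j, i.
  case/eqP: ij; f_equal; apply/val_inj; apply: (sqr_mod_inj pp (h2 i) (h2 j)).
  move/eqP: fij; rewrite eqn_modDl => /eqP fij.
  have cop : coprime p D by rewrite prime_coprime.
  wlog ji : i j fij / (j <= i)%N.
    move=> h; have [|/ltnW] := leqP j i => [ji|ij]; first exact: h.
    by apply/esym/h.
  move/eqP: fij; rewrite eqn_mod_dvd ?leq_mul2l ?leq_exp2r ?ji ?orbT // -mulnBr.
  by rewrite Gauss_dvdr // => h; apply/eqP; rewrite eqn_mod_dvd ?leq_exp2r.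
move=> /leq_card; rewrite card_sum !card_ord; lia.
Qed.

(** * Normal form of a node and its Tamagawa number *)

Section Reduction.
Variables (p : nat) (K : fieldType) (v : K -> int).
Hypotheses (pp : prime p) (Qp : Qp_field p v).
Implicit Types (W : weier K) (u r s t x y : K) (P : point K).

Lemma vge_modn (m n : nat) : m = n %[mod p] -> vge v (m%:R - n%:R) 1.
Proof.
move=> mn; rewrite (divn_eq m p) (divn_eq n p) mn !natrD !natrM.
rewrite (_ : _ - _ = ((m %/ p)%:R - (n %/ p)%:R) * p%:R); last by ring.
by have pv := veq_vge (veq_p Qp pp); vsolve Qp.
Qed.

(** At 2 every unit is 1 modulo p and (0, 1) works. At odd p, completing the square turns the
    equation into i^2 = 4 e + b2 j^2 with i = 2 y + a1 x and j = x. *)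
Lemma norm_form_residue a1 a2 e : vge v a1 0 -> vge v a2 0 ->
  veq v (a1 ^+ 2 + 4 * a2) 0 -> veq v e 0 ->
  exists x y, [/\ vge v x 0, vge v y 0 & vge v (y ^+ 2 + a1 * x * y - a2 * x ^+ 2 - e) 1].
Proof.
move=> a1i a2i b2u eu; have ei := veq_vge eu.
have [p2|op] := even_prime pp.
  exists 0, 1; rewrite vge0 (vge1 Qp); split=> //.
  have [k ek] := residue Qp pp ei.
  have ok : odd k.
    apply/negPn/negP => ek'; have /andP[_ /negP[]] := eu.
    rewrite add0r (_ : e = (e - k%:R) + k%:R); last by ring.
    apply: (vgeD Qp) => //; have := @vge_modn k 0; rewrite subr0; apply.
    by rewrite p2 modn2 (negPf ek').
  have k1 := @vge_modn 1 k ltac:(by rewrite p2 !modn2 ok).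
  rewrite (_ : _ - _ = (1%:R - k%:R) - (e - k%:R)); last by ring.
  by vsolve Qp.
have two : veq v 2 0.
  by apply: (unit_nat Qp pp); rewrite dvdn_prime2 //; apply: contraTneq op => ->.
have four : veq v 4 0 by rewrite (_ : 4 = 2 * 2); [exact: (veqM Qp two two) | ring].
have [D bD] := residue Qp pp (veq_vge b2u).
have [|E eE] := residue Qp pp (x := 4 * e); first by vsolve Qp.
have pD : ~~ (p %| D)%N.
  apply/negP => pD; have /andP[_ /negP[]] := b2u; set b := a1 ^+ 2 + 4 * a2 in bD *.
  rewrite add0r (_ : b = (b - D%:R) + D%:R); last by ring.
  apply: (vgeD Qp) => //; have := @vge_modn D 0; rewrite subr0; apply.
  by rewrite mod0n; apply/eqP.
have [i [j /vge_modn]] := square_affine_square_mod E pp op pD.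
rewrite natrD natrM !natrX => ij.
have i2 : vge v 2^-1 0 by apply: (veq_vge (veqV Qp two)).
exists j%:R, ((i%:R - a1 * j%:R) / 2); split; try by vsolve Qp.
rewrite -(vge_mul_veq Qp _ _ four) add0r.
have n2 := veq_neq0 two.
set b := a1 ^+ 2 + 4 * a2 in bD.
rewrite [X in vge v X _](_ : _ = (i%:R ^+ 2 - (E%:R + D%:R * j%:R ^+ 2)) - (b - D%:R) * j%:R ^+ 2
  - (4 * e - E%:R)); last by rewrite /b; field.
by apply: (vgeB Qp) => //; apply: (vgeB Qp) => //; apply: (vgeMl Qp) => //; vsolve Qp.
Qed.

Lemma disc_node_curve (a1 a2 c : K) :
  disc (node_curve a1 a2 c) = - c * ((a1 ^+ 2 + 4 * a2) ^+ 3 + 432 * c).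
Proof. by rewrite /disc /=; ring. Qed.

Lemma val_disc_node_curve a1 a2 c : veq v (a1 ^+ 2 + 4 * a2) 0 -> vge v c 1 -> c != 0 ->
  veq v (disc (node_curve a1 a2 c)) (v c).
Proof.
move=> b2u c1 c0; rewrite disc_node_curve -[v c]addr0; apply: (veqM Qp).
  by rewrite (veqN Qp) veq_val.
by apply: (veqD Qp (veqX Qp 3 b2u)); vsolve Qp.
Qed.

(** The new origin is an exact critical point of the defining polynomial, not a point of the curve:
    a3 and a4 vanish and the value there is left over as [c]. *)
Lemma node_normal_form W : singular_at_origin v W -> veq v (b2 W) 0 -> disc W != 0 ->
  exists r t c, [/\ vge v r 1, vge v t 1, veq v c (v (disc W)), 0 < v (disc W) &
    chvar W 1 r 0 t = node_curve (wa1 W) (wa2 W + 3 * r) c].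
Proof.
move=> [iW a3s a4s a6s] b2u d0.
have [a1i a2i a3i a4i a6i] := integral_modelP _ _ iW.
have b4s : vge v (b4 W) 1 by rewrite /b4; vsolve Qp.
(* This is half the derivative of 4 x^3 + b2 x^2 + 2 b4 x + b6; its linear coefficient [b2] is a
   unit. *)
have [r rs rE] : exists2 r, vge v r 1 & b4 W + b2 W * r + 6 * r ^+ 2 + 0 * r ^+ 3 = 0.
  by apply: (hensel_cubic Qp); rewrite ?vge0 // (vge_nat Qp).
have n2 : (2 : K) != 0 by apply: (natr_neq0 Qp).
pose t := - (wa1 W * r + wa3 W) / 2.
have t1 : 2 * t = - (wa1 W * r + wa3 W) by rewrite /t; field.
have t2 : wa1 W * t = 3 * r ^+ 2 + 2 * wa2 W * r + wa4 W.
  apply: (mulfI n2); apply: subr0_eq; rewrite -[RHS]oppr0 -[in RHS]rE /b4 /b2.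
  by rewrite mulrCA t1; ring.
(* [t] was defined with a division by 2, harmful at p = 2; but [2 * t] and [a1 * t] are both
   divisible by p, and [b2 * t] is an integral combination of them. *)
have ts : vge v t 1.
  rewrite -(vge_mul_veq Qp _ _ b2u) add0r.
  rewrite (_ : _ * t = wa1 W * (wa1 W * t) + 2 * wa2 W * (2 * t)); last by rewrite /b2; ring.
  by rewrite t1 t2; vsolve Qp.
pose c := wa6 (chvar W 1 r 0 t).
have WE : chvar W 1 r 0 t = node_curve (wa1 W) (wa2 W + 3 * r) c.
  rewrite /c; move: t1 t2 {c}; case: (W) => a1 a2 a3 a4 a6 /= t1 t2.
  rewrite /node_curve; f_equal.
  - by field; rewrite oner_neq0.
  - by field; rewrite oner_neq0.
  - by rewrite t1; field; rewrite oner_neq0.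
  - transitivity (a4 + 2 * r * a2 - a1 * t + 3 * r ^+ 2); first by field; rewrite oner_neq0.
    by rewrite t2; ring.
have cs : vge v c 1.
  rewrite /c; case: (W) a1i a2i a3s a4s a6s => a1 a2 a3 a4 a6 /= *.
  by rewrite expr1n divr1; vsolve Qp.
have dE : disc W = disc (node_curve (wa1 W) (wa2 W + 3 * r) c).
  by rewrite -WE -(disc_chvar W r 0 t (oner_neq0 _)) expr1n mul1r.
have c0 : c != 0.
  by apply: contraNneq d0 => c0; rewrite dE disc_node_curve c0 oppr0 mul0r.
have b2u' : veq v (wa1 W ^+ 2 + 4 * (wa2 W + 3 * r)) 0.
  rewrite (_ : _ + _ = b2 W + 12 * r); last by rewrite /b2; ring.
  by apply: (veqD Qp b2u); vsolve Qp.
have := val_disc_node_curve b2u' cs c0; rewrite -dE => dc.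
have vE : v (disc W) = v c by apply: (veq_uniq _ dc); apply: veq_val.
exists r, t, c; rewrite vE; split=> //; first exact: veq_val.
by move: cs; rewrite /vge (negPf c0) /=; vlia.
Qed.

Lemma node_reduced W : singular_at_origin v W -> veq v (b2 W) 0 -> disc W != 0 ->
  reduced v W.
Proof.
move=> [iW a3s a4s a6s] b2u d0; split=> //; right.
have [a1i a2i a3i a4i a6i] := integral_modelP _ _ iW.
by apply: (veqD Qp (veqX Qp 2 b2u)); rewrite /b4; vsolve Qp.
Qed.

Lemma bad_reduction_node W : singular_at_origin v W -> veq v (b2 W) 0 -> disc W != 0 ->
  bad_reduction v W.
Proof.
move=> sW b2u d0; apply/(bad_reduction_reduced pp Qp (node_reduced sW b2u d0)).
have [r [t [c [_ _ _ n0 _]]]] := node_normal_form sW b2u d0.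
by rewrite /vge (negPf d0) /=; vlia.
Qed.

Lemma tamagawa_split_node W s0 (n : nat) : singular_at_origin v W -> veq v (b2 W) 0 ->
  veq v (disc W) n -> vge v s0 0 -> vge v (s0 ^+ 2 + wa1 W * s0 - wa2 W) 1 ->
  tamagawa v W n.
Proof.
move=> sW b2u dn s0i s0E; have [iW _ _ _] := sW; have d0 := veq_neq0 dn.
have [a1i a2i _ _ _] := integral_modelP _ _ iW.
have [r [t [c [rs ts cn n0 WE]]]] := node_normal_form sW b2u d0.
have vd : v (disc W) = n by move: dn; rewrite veqE => /andP[_ /eqP].
rewrite vd in cn n0.
apply: (@tamagawa_chvar _ v W 1 r 0 t); rewrite ?oner_neq0 // WE.
pose a2 := wa2 W + 3 * r.
(* The derivative of the slope quadratic at its approximate root squares to its discriminant [b2]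
   modulo p. *)
have c1u : veq v (2 * s0 + wa1 W) 0.
  have : veq v ((2 * s0 + wa1 W) ^+ 2) 0.
    rewrite (_ : _ ^+ 2 = b2 W + 4 * (s0 ^+ 2 + wa1 W * s0 - wa2 W)); last by rewrite /b2; ring.
    by apply: (veqD Qp b2u); vsolve Qp.
  move=> /andP[_ h]; apply/andP; split; first by vsolve Qp.
  by apply: contraNN h => h; vsolve Qp.
have [z zs zE] : exists2 z, vge v z 1 & (s0 ^+ 2 + wa1 W * s0 - a2) + (2 * s0 + wa1 W) * z
    + 1 * z ^+ 2 + 0 * z ^+ 3 = 0.
  apply: (hensel_cubic Qp); rewrite ?vge0 ?(vge1 Qp) //.
  rewrite (_ : _ - _ = s0 ^+ 2 + wa1 W * s0 - wa2 W - 3 * r); last by rewrite /a2; ring.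
  by vsolve Qp.
(* Shearing by the exact slope [s] kills a2, and scaling by [al], the difference of the two slopes,
   makes a1 equal to 1. *)
pose s := s0 + z; pose al := wa1 W + 2 * s.
have sE : s ^+ 2 + wa1 W * s - a2 = 0 by rewrite -[RHS]zE /s; ring.
have alu : veq v al 0.
  rewrite (_ : al = 2 * s0 + wa1 W + 2 * z); last by rewrite /al /s; ring.
  by apply: (veqD Qp c1u); vsolve Qp.
have al0 := veq_neq0 alu.
apply: (@tamagawa_chvar _ v _ al 0 s 0) => //.
have c'n : veq v (c / al ^+ 6) n.
  by rewrite (veq_div Qp _ _ (veqX Qp 6 alu)) mulr0 addr0.
have -> : chvar (node_curve (wa1 W) (wa2 W + 3 * r) c) al 0 s 0 = split_curve (c / al ^+ 6).
  rewrite /split_curve /=; f_equal; try by field.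
    by rewrite -/al divff.
  transitivity (- (s ^+ 2 + wa1 W * s - a2) / al ^+ 2); first by rewrite /a2; field.
  by rewrite sE oppr0 mul0r.
set c' := c / _ in c'n *.
have sc := split_singular Qp n0 c'n.
apply: (tamagawa_reduced pp Qp); last exact: (index_split pp Qp).
apply: node_reduced => //.
  by rewrite /b2 /= (_ : _ + _ = 1) ?(veq1 Qp) //; ring.
apply: (@veq_neq0 _ v _ (v c')); apply: val_disc_node_curve.
- by rewrite (_ : _ + _ = 1) ?(veq1 Qp) //; ring.
- by apply: (vgeW _ (veq_vge c'n)); vlia.
- exact: veq_neq0 c'n.
Qed.

Lemma tamagawa_nonsplit_node W (n : nat) : singular_at_origin v W -> veq v (b2 W) 0 ->
  veq v (disc W) n -> anisotropic v (wa1 W) (wa2 W) ->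
  tamagawa v W (if ~~ odd n then 2 else 1).
Proof.
move=> sW b2u dn an; have [iW _ _ _] := sW; have d0 := veq_neq0 dn.
have [a1i a2i _ _ _] := integral_modelP _ _ iW.
have [r [t [c [rs ts cn n0 WE]]]] := node_normal_form sW b2u d0.
have vd : v (disc W) = n by move: dn; rewrite veqE => /andP[_ /eqP].
rewrite vd in cn n0.
apply: (@tamagawa_chvar _ v W 1 r 0 t); rewrite ?oner_neq0 // WE.
set a1 := wa1 W in a1i an *; set a2 := _ + _.
have a2i' : vge v a2 0 by rewrite /a2; vsolve Qp.
have an' : anisotropic v a1 a2.
  move=> l li; rewrite (_ : _ - _ = l ^+ 2 + a1 * l - wa2 W - 3 * r); last by rewrite /a2; ring.
  by apply: (veqD Qp (an l li)); vsolve Qp.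
have b2u' : veq v (a1 ^+ 2 + 4 * a2) 0.
  rewrite (_ : _ + _ = b2 W + 12 * r); last by rewrite /b2 /a2 /a1; ring.
  by apply: (veqD Qp b2u); vsolve Qp.
have sc := nonsplit_singular a1i a2i' n0 cn.
apply: (tamagawa_reduced pp Qp).
  apply: node_reduced => //; apply: (@veq_neq0 _ v _ (v c)).
  apply: val_disc_node_curve => //; last exact: veq_neq0 cn.
  by apply: (vgeW _ (veq_vge cn)); vlia.
have [on|en] /= := boolP (odd n).
  apply: (index_nonsplit_odd Qp a1i a2i' an' n0 cn) => M nM; clear -on nM; lia.
have nM : n%:Z = 2 * (n./2)%:Z by clear -en; lia.
have M0 : 0 < (n./2)%:Z by clear -n0 en; lia.
have cM := cn; rewrite nM in cM.
have [|x [y [oP x1 y1]]] := node_point_lift pp Qp a1i a2i' b2u' M0 cM.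
  apply: norm_form_residue => //.
  by rewrite (veq_div Qp _ _ (veqX Qp 2 (veq_pz Qp pp _))) add0r.
apply: (index_two_components Qp a1i a2i' an' n0 cn oP).
exact: (notin_E0 Qp sc x1 y1).
Qed.

End Reduction.

(** * Additive reduction of type IV and IV* *)

Section Additive.
Variables (p : nat) (K : fieldType) (v : K -> int).
Hypotheses (pp : prime p) (Qp : Qp_field p v).
Implicit Types (W : weier K) (u r s t x y : K) (P : point K).

(* Kodaira type IV for [e = 1] and IV* for [e = 2]. *)
Variables (e : int) (a1 a3 a4 : K).
Hypotheses (e12 : 1 <= e <= 2) (a1s : vge v a1 1) (a3s : vge v a3 e) (a4s : vge v a4 (e + 1)).

Lemma cusp_singular a6 : vge v a6 (2 * e) -> singular_at_origin v (Weier a1 0 a3 a4 a6).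
Proof.
move=> a6s; split; first apply/integral_modelP; rewrite /=; do ?split; rewrite ?vge0 //.
- exact: vgeW a1s.
- by apply: vgeW a3s; vlia.
- by apply: vgeW a4s; vlia.
- by apply: vgeW a6s; vlia.
- by apply: vgeW a3s; vlia.
- by apply: vgeW a4s; vlia.
- by apply: vgeW a6s; vlia.
Qed.

(** For e = 2 the equation is used twice: v x, v y >= 1 give v (y^2) >= 3, so v y >= 2, and then v
    (x^3) >= 4, so v x >= 2. What survives modulo p^(2 e + 1) is the quadratic in y whose roots
    index the components other than E_0. *)
Lemma cusp_point_val a6 x y : vge v a6 (2 * e) ->
  on_curve (Weier a1 0 a3 a4 a6) (Some (x, y)) -> vge v x 1 -> vge v y 1 ->
  [/\ vge v x e, vge v y e & vge v (y ^+ 2 + a3 * y - a6) (2 * e + 1)].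
Proof.
move=> a6s /eqP /= eq x1 y1.
have eqE : y ^+ 2 + a1 * x * y + a3 * y = x ^+ 3 + a4 * x + a6 by rewrite eq; ring.
suff [xe ye] : vge v x e /\ vge v y e.
  split=> //; rewrite (_ : _ - _ = x ^+ 3 + a4 * x - a1 * x * y); last first.
    have -> : x ^+ 3 + a4 * x = y ^+ 2 + a1 * x * y + a3 * y - a6 by rewrite eqE; ring.
    by ring.
  apply: (vgeB Qp); first apply: (vgeD Qp).
  - by apply: (vgeW _ (vgeX Qp 3 xe)); vlia.
  - by apply: (vgeW _ (vgeM Qp a4s xe)); vlia.
  - by apply: (vgeW _ (vgeM Qp (vgeM Qp a1s xe) ye)); vlia.
have [e1|e2] : e = 1 \/ e = 2 by vlia.
  by rewrite e1.
move: (a3s) (a4s) a6s; rewrite e2 => a3s' a4s' a6s'.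
have y2 : vge v y 2.
  apply: (vge_sqr Qp); rewrite (_ : y ^+ 2 = x ^+ 3 + a4 * x + a6 - a1 * x * y - a3 * y).
    apply: (vgeB Qp); first apply: (vgeB Qp); first apply: (vgeD Qp); first apply: (vgeD Qp).
    - exact: (vgeX Qp 3 x1).
    - by apply: (vgeW _ (vgeM Qp a4s' x1)).
    - by apply: (vgeW _ a6s').
    - by apply: (vgeW _ (vgeM Qp (vgeM Qp a1s x1) y1)).
    - by apply: (vgeW _ (vgeM Qp a3s' y1)).
  by rewrite -eqE; ring.
split=> //; apply: (vge_cube Qp).
rewrite (_ : x ^+ 3 = y ^+ 2 + a1 * x * y + a3 * y - a4 * x - a6).
  apply: (vgeB Qp); first apply: (vgeB Qp); first apply: (vgeD Qp); first apply: (vgeD Qp).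
  - exact: (vgeX Qp 2 y2).
  - by apply: (vgeW _ (vgeM Qp (vgeM Qp a1s x1) y2)).
  - by apply: (vgeW _ (vgeM Qp a3s' y2)).
  - by apply: (vgeW _ (vgeM Qp a4s' x1)).
  - by apply: (vgeW _ a6s').
by rewrite eqE; ring.
Qed.

Lemma index_cusp_one a6 : vge v a6 (2 * e) ->
  (forall y, vge v y e -> ~~ vge v (y ^+ 2 + a3 * y - a6) (2 * e + 1)) ->
  index_E0 v (Weier a1 0 a3 a4 a6) 1.
Proof.
move=> a6s irr; exists [:: None]; split=> //; first by move=> [|//] [|//].
move=> P oP; exists 0%N => //; rewrite negp0 addp0.
case: P oP => [[x y]|] oP; last exact: in_E0_0.
rewrite (in_E0P Qp (cusp_singular a6s) oP); apply/negP => /andP[x1 y1].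
by have [_ /irr/negP] := cusp_point_val a6s oP x1 y1.
Qed.

Section Three.
Hypothesis a3e : veq v a3 e.

Let W := Weier a1 0 a3 a4 0.

Let a60 : vge v 0 (2 * e). Proof. exact: vge0. Qed.

Let sW : singular_at_origin v W. Proof. exact: cusp_singular. Qed.

(** Two points of the same component: the denominator of the slope has valuation exactly e and the
    numerator more, so l vanishes modulo p and the sum returns to the cusp. *)
Lemma cusp_add_same x1 y1 x2 y2 : on_curve W (Some (x1, y1)) -> on_curve W (Some (x2, y2)) ->
  vge v x1 e -> vge v x2 e -> veq v (y1 + y2 + a3) e -> vge v y1 e -> vge v y2 e ->
  ~~ in_E0 v W (addp W (Some (x1, y1)) (Some (x2, y2))).
Proof.
move=> oP oQ x1e x2e ye y1e y2e.
have D : veq v (y1 + y2 + a1 * x1 + a3) e.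
  rewrite (_ : _ + a3 = y1 + y2 + a3 + a1 * x1); last by ring.
  apply: (veqD Qp ye); rewrite addrC; exact: (vgeM Qp).
have [[x12 [_ yE]]|[l [_ l2 ->]]] := addp_slope oP oQ.
  by have := veq_neq0 D; rewrite x12 yE eqxx.
have l1 : vge v l 1.
  rewrite -(vge_mul_veq Qp _ _ D) mulrC l2 /=.
  rewrite mul0r addr0; apply: (vgeB Qp); last first.
    by rewrite addrC; apply: (vgeM Qp).
  apply: (vgeD Qp) => //; apply: (vgeD Qp); first apply: (vgeD Qp).
  - by apply: (vgeW _ (vgeX Qp 2 x1e)); vlia.
  - by apply: (vgeW _ (vgeM Qp x1e x2e)); vlia.
  - by apply: (vgeW _ (vgeX Qp 2 x2e)); vlia.
have [x1s x2s] : vge v x1 1 /\ vge v x2 1 by split; [apply: vgeW x1e|apply: vgeW x2e]; vlia.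
have [y1s a3s1] : vge v y1 1 /\ vge v a3 1 by split; [apply: vgeW y1e|apply: vgeW a3s]; vlia.
have x3s : vge v (l ^+ 2 + a1 * l - 0 - x1 - x2) 1 by vsolve Qp.
by apply: (notin_E0 Qp sW) => //=; vsolve Qp.
Qed.

(** Two points of opposite components: a sum at the cusp would force p | l, and l (x1 - x2) would be
    too divisible to equal y1 - y2. *)
Lemma cusp_add_opp x1 y1 x2 y2 : on_curve W (Some (x1, y1)) -> on_curve W (Some (x2, y2)) ->
  vge v x1 e -> vge v x2 e -> veq v (y1 - y2) e ->
  in_E0 v W (addp W (Some (x1, y1)) (Some (x2, y2))).
Proof.
move=> oP oQ x1e x2e ye; have oPQ := on_curve_addp oP oQ.
have [[_ [-> _]]|[l [l1 _ E]]] := addp_slope oP oQ; first exact: in_E0_0.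
rewrite E in oPQ *; rewrite (in_E0P Qp sW oPQ); apply/negP => /andP[x3s _].
have [x1s x2s] : vge v x1 1 /\ vge v x2 1 by split; [apply: vgeW x1e|apply: vgeW x2e]; vlia.
have ls : vge v (l ^+ 2 + a1 * l) 1.
  set x3 := (X in vge v X 1) in x3s.
  by rewrite (_ : _ + _ = x3 + x1 + x2); [vsolve Qp | rewrite /x3 /=; ring].
have li : vge v l 0.
  apply: (@integral_root p K v Qp l 0 0 (- (l ^+ 2 + a1 * l)) a1 1);
    rewrite ?vge0 ?(veq1 Qp) //; last by ring.
  - by vsolve Qp.
  - exact: vgeW a1s.
have l1s : vge v l 1.
  apply: (vge_sqr Qp); rewrite (_ : l ^+ 2 = (l ^+ 2 + a1 * l) - a1 * l); last by ring.
  by vsolve Qp.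
have /andP[_ /negP[]] := ye; rewrite -l1 [e + 1]addrC; apply: (vgeM Qp) => //.
exact: (vgeB Qp).
Qed.

(** The quadratic is y (y + a3), with roots distinct after division by p^e; (0, 0) and (0, - a3)
    represent them and are negatives of each other. *)
Lemma index_cusp_three : index_E0 v W 3.
Proof.
have o1 : on_curve W (Some (0, 0)) by apply/eqP; ring.
have o2 : on_curve W (Some (0, - a3)) by apply/eqP; ring.
have n1 : negp W (Some (0, 0)) = Some (0, - a3) by rewrite negpE; congr (Some (_, _)) => /=; ring.
have n2 : negp W (Some (0, - a3)) = Some (0, 0) by rewrite negpE; congr (Some (_, _)) => /=; ring.
have a31 : vge v a3 1 by apply: vgeW a3s; vlia.
have nE1 : ~~ in_E0 v W (Some (0, 0)) by apply: (notin_E0 Qp sW); rewrite vge0.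
have nE2 : ~~ in_E0 v W (Some (0, - a3)).
  by apply: (notin_E0 Qp sW); rewrite ?vge0 ?(vgeN Qp).
have Na3e : vge v (- a3) e by rewrite (vgeN Qp).
exists [:: None; Some (0, 0); Some (0, - a3)]; split=> //.
- by apply/and3P; split=> //; rewrite o2.
- move=> [|[|[|//]]] [|[|[|//]]] // _ _ _; rewrite ?[nth _ _ _]/= ?negp0 ?addp0 ?add0p ?n1 ?n2 //.
  + apply: cusp_add_same; rewrite ?vge0 //.
    by rewrite (_ : _ + _ = a3) //; ring.
  + by apply: cusp_add_same; rewrite ?vge0 // (_ : _ + _ = - a3) ?(veqN Qp) //; ring.
move=> P oP; have [PE|] := boolP (in_E0 v W P).
  by exists 0%N => //; rewrite negp0 addp0.
case: P oP => [[x y]|] oP; last by rewrite in_E0_0.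
rewrite (in_E0P Qp sW oP) negbK => /andP[x1 y1].
have [xe ye h] := cusp_point_val a60 oP x1 y1.
have [|ys|ys] := @vge_mul_split _ _ _ Qp y (y + a3) (e + 1).
- rewrite (_ : y * _ = y ^+ 2 + a3 * y - 0); last by ring.
  by rewrite (_ : 2 * (e + 1) - 1 = 2 * e + 1) //; ring.
- exists 1%N => //; rewrite [nth _ _ _]/= n1; apply: cusp_add_opp; rewrite ?vge0 //.
  by rewrite opprK; apply: (veqD' Qp).
- exists 2%N => //; rewrite [nth _ _ _]/= n2; apply: cusp_add_opp; rewrite ?vge0 //.
  by rewrite subr0 (_ : y = (y + a3) - a3); [apply: (veqD' Qp); rewrite ?(veqN Qp) | ring].
Qed.

End Three.

End Additive.

(** * The two curves *)

Lemma Fp_nat_eq0 (p k : nat) : prime p -> ((k%:R : 'F_p) == 0) = (p %| k)%N.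
Proof. by move=> pp; rewrite -(dvdn_pcharf (pchar_Fp pp)). Qed.

Lemma cube_sub1 (R : comNzRingType) (x : R) : x ^+ 3 - 1 = (x - 1) * (x ^+ 2 + x + 1).
Proof. by ring. Qed.

Lemma cube_root_of_unity_mod (p : nat) : prime p -> (p %% 6 = 1)%N ->
  exists w, (p %| w ^ 2 + w + 1)%N.
Proof.
move=> pp p6; have /(Cauchy (isT : prime 3))[x _ ox] : (3 %| #|[set: {unit 'F_p}]%g|)%N.
  rewrite finalg.card_finField_unit card_Fp //; clear -p6; lia.
have [z z3 z1] : exists2 z : 'F_p, z ^+ 3 = 1 & z != 1.
  exists (val x); first by rewrite -FinRing.val_unitX -ox expg_order.
  apply/eqP => x1; have : x = 1%g by apply: val_inj.
  by move/eqP; rewrite -order_eq1 ox.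
exists z; rewrite -Fp_nat_eq0 // !natrD natrX natr_Zp.
have : (z - 1) * (z ^+ 2 + z + 1) = 0.
  by rewrite -cube_sub1 z3 subrr.
by move/eqP; rewrite mulf_eq0 subr_eq0 (negPf z1).
Qed.

(** Here p is 2 modulo 3, so a cube root of unity satisfies z = z^p = z^2; thus z = 1, and z^2 + z +
    1 = 3 is not zero. *)
Lemma no_cube_root_of_unity_mod (p w : nat) : prime p -> (p %% 6 = 2 \/ p %% 6 = 5)%N ->
  ~~ (p %| w ^ 2 + w + 1)%N.
Proof.
move=> pp p6; apply/negP; rewrite -Fp_nat_eq0 // !natrD natrX; set z := w%:R => /eqP z0.
have z3 : z ^+ 3 = 1.
  by apply: subr0_eq; rewrite cube_sub1 z0 mulr0.
have zp k : k = #|'F_p| -> z ^+ k = z by move=> ->; apply: expf_card.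
have := zp (3 * (p %/ 3) + 2)%N; rewrite card_Fp // exprD exprM z3 expr1n mul1r => z2.
have {}z2 : z ^+ 2 = z by apply: z2; clear -p6; lia.
have z1 : z = 1 by rewrite -z3 exprS z2 -expr2.
have : (3%:R : 'F_p) == 0 by apply/eqP; rewrite -z0 z1; ring.
rewrite Fp_nat_eq0 // dvdn_prime2 // => /eqP p3; lia.
Qed.

Section Models.
Variables (p : nat) (K : fieldType) (v : K -> int).
Hypotheses (pp : prime p) (Qp : Qp_field p v).
Variables (A B : K).

Let E := Weier A 0 (A ^+ 2 * B) 0 0.
Let Et := Weier A 0 (A ^+ 2 * B) (- 5 * A ^+ 3 * B) (- (A ^+ 4 * B * (A + 7 * B))).

Lemma disc_E : disc E = A ^+ 8 * B ^+ 3 * (A - 27 * B).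
Proof. by rewrite /disc /=; ring. Qed.

Lemma disc_Et : disc Et = A ^+ 8 * B * (A - 27 * B) ^+ 3.
Proof. by rewrite /disc /=; ring. Qed.

Section PrimeDividesB.
Variable n : nat.
Hypotheses (n0 : (0 < n)%N) (A0 : veq v A 0) (Bn : veq v B n).

Let B1 : vge v B 1. Proof. by apply: (vgeW _ (veq_vge Bn)); vlia. Qed.

Let D0 : veq v (A - 27 * B) 0.
Proof. by have B1' := B1; apply: (veqD Qp A0); vsolve Qp. Qed.

Let singular_E : singular_at_origin v E.
Proof.
by have B1' := B1; split; first (apply/integral_modelP; split); rewrite /=; vsolve Qp.
Qed.

Let singular_Et : singular_at_origin v Et.
Proof.
by have B1' := B1; split; first (apply/integral_modelP; split); rewrite /=; vsolve Qp.
Qed.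

Let disc_E_val : veq v (disc E) (3 * n)%N.
Proof.
rewrite disc_E (_ : (3 * n)%N%:Z = 8 * 0 + 3 * n%:Z + 0); last by vlia.
by apply: (veqM Qp) => //; apply: (veqM Qp); [apply: (veqX Qp 8) | apply: (veqX Qp 3)].
Qed.

Let disc_Et_val : veq v (disc Et) n.
Proof.
rewrite disc_Et (_ : n%:Z = 8 * 0 + n%:Z + 3 * 0); last by vlia.
apply: (veqM Qp); last exact: (veqX Qp 3).
by apply: (veqM Qp) => //; apply: (veqX Qp 8).
Qed.

Let b2_unit a3 a4 a6 : veq v (b2 (Weier A 0 a3 a4 a6)) 0.
Proof. by rewrite /b2 /= mulr0 addr0; apply: (veqX0 Qp). Qed.

(** Modulo p both curves become y^2 + a x y = x^3, whose node has the rational tangent slopes 0 and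
    - a at every prime, 3 included. *)
Lemma curves_at_prime_dividing_b : [/\ bad_reduction v E, bad_reduction v Et,
  tamagawa v E (3 * n) & tamagawa v Et n].
Proof.
have split0 : vge v (0 ^+ 2 + A * 0 - 0) 1 by rewrite expr0n mulr0 !addr0 subr0 vge0.
split.
- exact: (bad_reduction_node pp Qp singular_E (b2_unit _ _ _) (veq_neq0 disc_E_val)).
- exact: (bad_reduction_node pp Qp singular_Et (b2_unit _ _ _) (veq_neq0 disc_Et_val)).
- exact: (tamagawa_split_node pp Qp singular_E (b2_unit _ _ _) disc_E_val (vge0 v 0) split0).
- exact: (tamagawa_split_node pp Qp singular_Et (b2_unit _ _ _) disc_Et_val (vge0 v 0) split0).
Qed.

End PrimeDividesB.

Hypothesis p3 : p != 3%N.

Let three : veq v 3 0.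
Proof. by apply: (unit_nat Qp pp); rewrite dvdn_prime2. Qed.

Let twentyseven : veq v 27 0.
Proof. by rewrite (_ : 27 = 3 ^+ 3); [apply: (veqX0 Qp) | ring]. Qed.

Let three0 : (3 : K) != 0. Proof. exact: veq_neq0 three. Qed.

Lemma cube_root_of_unity : (p %% 6 = 1)%N -> exists2 w, vge v w 0 & vge v (w ^+ 2 + w + 1) 1.
Proof.
move=> /(cube_root_of_unity_mod pp)[w pw]; exists w%:R; first exact: (vge_nat Qp).
have -> : w%:R ^+ 2 + w%:R + 1 = (w ^ 2 + w + 1)%N%:~R :> K by rewrite -pmulrn !natrD natrX.
by rewrite (vge_intE Qp pp _ 1) expn1.
Qed.

Lemma no_cube_root_of_unity x : (p %% 6 = 2 \/ p %% 6 = 5)%N -> vge v x 0 ->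
  veq v (x ^+ 2 + x + 1) 0.
Proof.
move=> p6 xi; have [k xk] := residue Qp pp xi.
have := unit_nat Qp pp (no_cube_root_of_unity_mod k pp p6); rewrite !natrD natrX => ku.
rewrite (_ : _ + 1 = (k%:R ^+ 2 + k%:R + 1) + (x - k%:R) * (x + k%:R + 1)); last by ring.
by apply: (veqD Qp ku); apply: (vgeMl Qp) => //; vsolve Qp.
Qed.

Section PrimeDividesD.
Variable n : nat.
Hypotheses (n0 : (0 < n)%N) (A0 : veq v A 0) (B0 : veq v B 0) (Dn : veq v (A - 27 * B) n).

Let D := A - 27 * B.
Let D1 : vge v D 1. Proof. by apply: (vgeW _ (veq_vge Dn)); vlia. Qed.

(* The nodes are those of the singular curves at [a = 27 b]. *)
Let F := Weier A (- A ^+ 2 / 3) (- A ^+ 2 * D / 27) 0 (A ^+ 5 * D / 27 ^+ 2).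
Let Ft := Weier A (- A ^+ 2) (- A ^+ 2 * D / 27) (5 * A ^+ 3 * D / 27)
  (- 7 * A ^+ 4 * D ^+ 2 / 27 ^+ 2).

Let shift_E : chvar E 1 (- A ^+ 2 / 9) 0 (A ^+ 3 / 27) = F.
Proof.
by rewrite /F /D /=; f_equal; field; rewrite ?oner_neq0 ?(natr_neq0 Qp).
Qed.

Let shift_Et : chvar Et 1 (- A ^+ 2 / 3) 0 (4 * A ^+ 3 / 27) = Ft.
Proof.
by rewrite /Ft /D /=; f_equal; field; rewrite ?oner_neq0 ?(natr_neq0 Qp).
Qed.

Let inv_int x : veq v x 0 -> vge v x^-1 0.
Proof. by move=> xu; apply: (veq_vge (veqV Qp xu)). Qed.

Let singular_F : singular_at_origin v F.
Proof.
have D1' := D1; have i3 := inv_int three; have i27 := inv_int twentyseven.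
by split; first (apply/integral_modelP; split); rewrite /= -?exprVn; vsolve Qp.
Qed.

Let singular_Ft : singular_at_origin v Ft.
Proof.
have D1' := D1; have i3 := inv_int three; have i27 := inv_int twentyseven.
by split; first (apply/integral_modelP; split); rewrite /= -?exprVn; vsolve Qp.
Qed.

Let disc_F_val : veq v (disc F) n.
Proof.
rewrite -shift_E -[disc _]mul1r -[X in X * _](expr1n _ 12) disc_chvar ?oner_neq0 // disc_E.
rewrite (_ : n%:Z = 8 * 0 + 3 * 0 + n%:Z); last by vlia.
by apply: (veqM Qp) => //; apply: (veqM Qp); [apply: (veqX Qp 8) | apply: (veqX Qp 3)].
Qed.

Let disc_Ft_val : veq v (disc Ft) (3 * n)%N.
Proof.
rewrite -shift_Et -[disc _]mul1r -[X in X * _](expr1n _ 12) disc_chvar ?oner_neq0 // disc_Et.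
rewrite (_ : (3 * n)%N%:Z = 8 * 0 + 0 + 3 * n%:Z); last by vlia.
apply: (veqM Qp); last exact: (veqX Qp 3).
by apply: (veqM Qp) => //; apply: (veqX Qp 8).
Qed.

Let b2_F : veq v (b2 F) 0.
Proof.
rewrite /b2 /= (_ : _ + _ = - (A ^+ 2) / 3); last by field.
by rewrite (veq_div Qp _ _ three) addr0 (veqN Qp); apply: (veqX0 Qp).
Qed.

Let b2_Ft : veq v (b2 Ft) 0.
Proof.
rewrite /b2 /= (_ : _ + _ = - (3 * A ^+ 2)); last by ring.
by rewrite (veqN Qp) -[0]addr0; apply: (veqM Qp three); apply: (veqX0 Qp).
Qed.

Lemma bad_reduction_at_D : bad_reduction v E /\ bad_reduction v Et.
Proof.
split.
  apply/(bad_reduction_chvar v E (- A ^+ 2 / 9) 0 (A ^+ 3 / 27) (oner_neq0 K)).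
  rewrite shift_E; exact: (bad_reduction_node pp Qp singular_F b2_F (veq_neq0 disc_F_val)).
apply/(bad_reduction_chvar v Et (- A ^+ 2 / 3) 0 (4 * A ^+ 3 / 27) (oner_neq0 K)).
rewrite shift_Et; exact: (bad_reduction_node pp Qp singular_Ft b2_Ft (veq_neq0 disc_Ft_val)).
Qed.

(** The slopes at the two nodes solve s^2 + A s + A^2 / 3 = 0 and s^2 + A s + A^2 = 0 modulo p, with
    roots A (w - 1) / 3 and A w for w a primitive cube root of unity. *)
Lemma tamagawa_at_D_split : (p %% 6 = 1)%N -> tamagawa v E n /\ tamagawa v Et (3 * n).
Proof.
move=> /cube_root_of_unity[w wi w1]; have i3 := inv_int three; split.
  apply: (@tamagawa_chvar _ v E 1 (- A ^+ 2 / 9) 0 (A ^+ 3 / 27) _ (oner_neq0 K)); rewrite shift_E.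
  apply: (tamagawa_split_node pp Qp singular_F b2_F disc_F_val (s0 := A * (w - 1) / 3)).
    by vsolve Qp.
  rewrite /= (_ : _ - _ = (w ^+ 2 + w + 1) * (A / 3) ^+ 2); last by field.
  by vsolve Qp.
apply: (@tamagawa_chvar _ v Et 1 (- A ^+ 2 / 3) 0 (4 * A ^+ 3 / 27) _ (oner_neq0 K)).
rewrite shift_Et.
apply: (tamagawa_split_node pp Qp singular_Ft b2_Ft disc_Ft_val (s0 := A * w)).
  by vsolve Qp.
rewrite /= (_ : _ - _ = (w ^+ 2 + w + 1) * A ^+ 2); last by ring.
by vsolve Qp.
Qed.

Lemma tamagawa_at_D_nonsplit : (p %% 6 = 2 \/ p %% 6 = 5)%N ->
  tamagawa v E (if ~~ odd n then 2 else 1) /\ tamagawa v Et (if ~~ odd n then 2 else 1).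
Proof.
move=> p6; have An0 := veq_neq0 A0; have iA := inv_int A0; split.
  apply: (@tamagawa_chvar _ v E 1 (- A ^+ 2 / 9) 0 (A ^+ 3 / 27) _ (oner_neq0 K)); rewrite shift_E.
  apply: (tamagawa_nonsplit_node pp Qp singular_F b2_F disc_F_val) => l li /=.
  have wu := @no_cube_root_of_unity (3 * l / A + 1) p6 ltac:(vsolve Qp).
  rewrite (_ : _ - _ = ((3 * l / A + 1) ^+ 2 + (3 * l / A + 1) + 1) * (A / 3) ^+ 2); last first.
    by field; rewrite ?An0 ?(natr_neq0 Qp).
  rewrite -[0]addr0; apply: (veqM Qp wu); apply: (veqX0 Qp).
  by rewrite (veq_div Qp _ _ three) addr0.
apply: (@tamagawa_chvar _ v Et 1 (- A ^+ 2 / 3) 0 (4 * A ^+ 3 / 27) _ (oner_neq0 K)).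
rewrite shift_Et.
have := tamagawa_nonsplit_node pp Qp singular_Ft b2_Ft disc_Ft_val.
(* The exponents 3 n and n have the same parity, so the two curves get the same number. *)
rewrite oddM /=; apply=> l li /=.
have wu := @no_cube_root_of_unity (l / A) p6 ltac:(vsolve Qp).
rewrite (_ : _ - _ = ((l / A) ^+ 2 + l / A + 1) * A ^+ 2); last by field.
by rewrite -[0]addr0; apply: (veqM Qp wu); apply: (veqX0 Qp).
Qed.

End PrimeDividesD.

Lemma chvar_scale (a1 a3 a4 a6 u : K) : u != 0 ->
  chvar (Weier a1 0 a3 a4 a6) u 0 0 0 = Weier (a1 / u) 0 (a3 / u ^+ 3) (a4 / u ^+ 4) (a6 / u ^+ 6).
Proof. by move=> u0 /=; f_equal; field. Qed.

(** The discriminants have valuation 24 k, and scaling by p^(2 k) makes them units while keeping the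
    models integral. *)
Lemma good_reduction (k : nat) : veq v A (3 * k)%N -> veq v B 0 -> veq v (A - 27 * B) 0 ->
  ~ bad_reduction v E /\ ~ bad_reduction v Et.
Proof.
move=> Ak B0 D0; pose u : K := p%:R ^ (2 * k%:Z).
have uk : veq v u (2 * k%:Z) by apply: (veq_pz Qp pp).
have u0 := veq_neq0 uk.
have Au : vge v (A / u) 0 by rewrite (vge_div Qp _ _ uk); apply: (vgeW _ (veq_vge Ak)); vlia.
have Bi := veq_vge B0.
have Aku (i j : nat) : (2 * j <= 3 * i)%N -> vge v (A ^+ i / u ^+ j) 0.
  move=> ij; rewrite (vge_div Qp _ _ (veqX Qp j uk)).
  by apply: (vgeW _ (veq_vge (veqX Qp i Ak))); clear -ij; nia.
have h W : integral_model v (chvar W u 0 0 0) -> veq v (disc W) (24 * k%:Z) ->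
    ~ bad_reduction v W.
  move=> iW dW /(bad_reduction_chvar v W 0 0 0 u0).
  have dW' : veq v (disc (chvar W u 0 0 0)) 0.
    have := veqM Qp (veqV Qp (veqX Qp 12 uk)) dW.
    rewrite -(disc_chvar W 0 0 0 u0) (mulKf (expf_neq0 12 u0)).
    by rewrite (_ : - _ + _ = 0) //; vlia.
  have rW : reduced v (chvar W u 0 0 0).
    split=> //; first exact: veq_neq0 dW'.
    by left; move: dW'; rewrite veqE => /andP[_ /eqP->].
  by move/(bad_reduction_reduced pp Qp rW); have /andP[_ /negP] := dW'.
have A23 := Aku 2%N 3%N isT; have A34 := Aku 3%N 4%N isT; have A46 := Aku 4%N 6%N isT.
split; apply: h.
- rewrite chvar_scale // !mul0r; apply/integral_modelP; split=> //=; rewrite ?vge0 //.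
  by rewrite mulrAC; apply: (vgeM0 Qp).
- rewrite disc_E (_ : 24 * k%:Z = 8 * (3 * k)%N%:Z + 3 * 0 + 0); last by vlia.
  by apply: (veqM Qp) => //; apply: (veqM Qp); [apply: (veqX Qp 8) | apply: (veqX Qp 3)].
- rewrite chvar_scale //; apply/integral_modelP; split=> //=; rewrite ?vge0 //.
  + by rewrite mulrAC; apply: (vgeM0 Qp).
  + rewrite (_ : _ / _ = - 5 * B * (A ^+ 3 / u ^+ 4)); last by field.
    by apply: (vgeM0 Qp) => //; vsolve Qp.
  + rewrite (_ : _ / _ = - (A ^+ 4 / u ^+ 6) * (B * (A + 7 * B))); last by field.
    have Ai : vge v A 0 by apply: (vgeW _ (veq_vge Ak)); vlia.
    by apply: (vgeM0 Qp); [rewrite (vgeN Qp) | vsolve Qp].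
- rewrite disc_Et (_ : 24 * k%:Z = 8 * (3 * k)%N%:Z + 0 + 3 * 0); last by vlia.
  apply: (veqM Qp); last exact: (veqX Qp 3).
  by apply: (veqM Qp) => //; apply: (veqX Qp 8).
Qed.

Section PrimeDividesA.
Variables (k : nat) (e : int).
Hypotheses (e12 : 1 <= e <= 2) (Ak : veq v A (3 * k%:Z + 3 - e)) (B0 : veq v B 0).

(** With this exponent the scaled a3 has valuation exactly e and the discriminants 4 e, that is 4
    for type IV and 8 for IV*. *)
Let u : K := p%:R ^ (2 * k%:Z + 2 - e).
Let uk : veq v u (2 * k%:Z + 2 - e). Proof. exact: (veq_pz Qp pp). Qed.
Let u0 : u != 0. Proof. exact: veq_neq0 uk. Qed.

Let A1 : vge v A 1. Proof. by apply: (vgeW _ (veq_vge Ak)); vlia. Qed.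

Let g := A ^+ 2 * B / u ^+ 3.
Let d := A / B.
Let a4 := - 5 * A ^+ 3 * B / u ^+ 4.

Let ge : veq v g e.
Proof.
rewrite /g (veq_div Qp _ _ (veqX Qp 3 uk)).
rewrite (_ : e + _ = 2 * (3 * k%:Z + 3 - e) + 0); last by vlia.
by apply: (veqM Qp) => //; apply: (veqX Qp 2).
Qed.

Let Au : vge v (A / u) 1.
Proof. by rewrite (vge_div Qp _ _ uk); apply: (vgeW _ (veq_vge Ak)); vlia. Qed.

Let d1 : vge v d 1.
Proof. by rewrite (vge_div Qp _ _ B0) addr0. Qed.

Let a4e : vge v a4 (e + 1).
Proof.
rewrite /a4 (_ : _ / _ = A ^+ 3 / u ^+ 4 * (- 5 * B)); last by field.
apply: (vgeMl Qp); last by have Bi := veq_vge B0; vsolve Qp.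
rewrite (vge_div Qp _ _ (veqX Qp 4 uk)).
by apply: (vgeW _ (veq_vge (veqX Qp 3 Ak))); vlia.
Qed.

Let scale_E : chvar E u 0 0 0 = Weier (A / u) 0 g 0 0.
Proof. by rewrite chvar_scale // !mul0r. Qed.

Let scale_Et : chvar Et u 0 0 0 = Weier (A / u) 0 g a4 (- g ^+ 2 * (7 + d)).
Proof.
rewrite chvar_scale //; congr (Weier _ _ _ _ _).
by rewrite /g /d; field; rewrite u0 (veq_neq0 B0).
Qed.

Let D0 : veq v (A - 27 * B) 0.
Proof.
rewrite addrC; apply: (veqD Qp); last by rewrite add0r.
by rewrite (veqN Qp) -[0]addr0; apply: (veqM Qp twentyseven).
Qed.

Let disc_val W : veq v (disc W) (8 * (3 * k%:Z + 3 - e)) ->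
  veq v (disc (chvar W u 0 0 0)) (4 * e).
Proof.
move=> dW; have := veqM Qp (veqV Qp (veqX Qp 12 uk)) dW.
rewrite -(disc_chvar W 0 0 0 u0) (mulKf (expf_neq0 12 u0)).
by rewrite (_ : - _ + _ = 4 * e) //; vlia.
Qed.

Let disc_E_val : veq v (disc (chvar E u 0 0 0)) (4 * e).
Proof.
apply: disc_val; rewrite disc_E -[X in veq _ _ X]addr0 -[X in veq _ _ (X + _)]addr0.
by apply: (veqM Qp) => //; apply: (veqM Qp); [apply: (veqX Qp 8) | apply: (veqX0 Qp)].
Qed.

Let disc_Et_val : veq v (disc (chvar Et u 0 0 0)) (4 * e).
Proof.
apply: disc_val; rewrite disc_Et -[X in veq _ _ X]addr0 -[X in veq _ _ (X + _)]addr0.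
apply: (veqM Qp); last exact: (veqX0 Qp).
by apply: (veqM Qp) => //; apply: (veqX Qp 8).
Qed.

Let cusp_reduced W : singular_at_origin v W -> veq v (disc W) (4 * e) -> reduced v W.
Proof.
move=> [iW _ _ _] dW; split=> //; first exact: veq_neq0 dW.
by left; move: dW; rewrite veqE => /andP[_ /eqP->]; vlia.
Qed.

Let a6e : vge v (- g ^+ 2 * (7 + d)) (2 * e).
Proof.
apply: (vgeMl Qp); last by vsolve Qp.
by rewrite (vgeN Qp); apply: (vgeX Qp 2 (veq_vge ge)).
Qed.

Let singular_E : singular_at_origin v (chvar E u 0 0 0).
Proof.
by rewrite scale_E; apply: (cusp_singular e12) => //; rewrite ?vge0 //; apply: veq_vge.
Qed.

Let singular_Et : singular_at_origin v (chvar Et u 0 0 0).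
Proof. by rewrite scale_Et; apply: (cusp_singular e12) => //; apply: veq_vge. Qed.

Lemma bad_reduction_at_A : bad_reduction v E /\ bad_reduction v Et.
Proof.
have bad W : singular_at_origin v (chvar W u 0 0 0) ->
    veq v (disc (chvar W u 0 0 0)) (4 * e) -> bad_reduction v W.
  move=> sW dW; apply/(bad_reduction_chvar v W 0 0 0 u0).
  apply/(bad_reduction_reduced pp Qp (cusp_reduced sW dW)).
  by apply: (vgeW _ (veq_vge dW)); vlia.
by split; apply: bad.
Qed.

Lemma tamagawa_E_at_A : tamagawa v E 3.
Proof.
apply: (@tamagawa_chvar _ v E u 0 0 0 _ u0).
apply: (tamagawa_reduced pp Qp (cusp_reduced singular_E disc_E_val)).
by rewrite scale_E; apply: (index_cusp_three Qp e12) => //; rewrite ?vge0 //; apply: veq_vge.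
Qed.

(* The roots of the reduction of [Y ^ 2 + g Y - a6] are [g (3 w + 1)] with [w ^ 2 + w + 1 = 0]. *)
Lemma tamagawa_Et_at_A_split : (p %% 6 = 1)%N -> tamagawa v Et 3.
Proof.
move=> /cube_root_of_unity[w wi w1].
(* This is s^2 + s + 7 + d expanded at s = 3 w + 1 + z; translating y by [g * s] then kills a6
   exactly. *)
have [z zs zE] : exists2 z, vge v z 1 & (9 * (w ^+ 2 + w + 1) + d) + (2 * (3 * w + 1) + 1) * z
    + 1 * z ^+ 2 + 0 * z ^+ 3 = 0.
  apply: (hensel_cubic Qp); rewrite ?vge0 ?(vge1 Qp) //; first by vsolve Qp.
  have : veq v ((2 * (3 * w + 1) + 1) ^+ 2) 0.
    rewrite (_ : _ ^+ 2 = - 27 + 36 * (w ^+ 2 + w + 1)); last by ring.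
    by apply: (veqD Qp); [rewrite (veqN Qp) | vsolve Qp].
  move=> /andP[_ h]; apply/andP; split; first by vsolve Qp.
  by apply: contraNN h => h; vsolve Qp.
pose s := 3 * w + 1 + z.
have sE : s ^+ 2 + s + 7 + d = 0 by rewrite -[RHS]zE /s; ring.
have su : veq v (2 * s + 1) 0.
  have : veq v ((2 * s + 1) ^+ 2) 0.
    rewrite (_ : _ ^+ 2 = 4 * (s ^+ 2 + s + 7 + d) - 27 - 4 * d); last by ring.
    rewrite sE mulr0 sub0r; apply: (veqD Qp); first by rewrite (veqN Qp).
    by vsolve Qp.
  move=> /andP[_ h]; apply/andP; split; first by rewrite /s; vsolve Qp.
  by apply: contraNN h => h; vsolve Qp.
have si : vge v s 0 by rewrite /s; vsolve Qp.
have shift : chvar (chvar Et u 0 0 0) 1 0 0 (g * s)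
    = Weier (A / u) 0 (g * (2 * s + 1)) (a4 - g * s * (A / u)) 0.
  rewrite scale_Et /=; f_equal; try by field; rewrite oner_neq0 ?u0.
  transitivity (- g ^+ 2 * (s ^+ 2 + s + 7 + d)); first by field; rewrite oner_neq0.
  by rewrite sE mulr0.
have g'e : veq v (g * (2 * s + 1)) e by rewrite -[e]addr0; apply: (veqM Qp).
have a4'e : vge v (a4 - g * s * (A / u)) (e + 1).
  apply: (vgeB Qp) => //; apply: (vgeM Qp) => //.
  by apply: (vgeMl Qp) => //; apply: veq_vge.
apply: (@tamagawa_chvar _ v Et u 0 0 0 _ u0).
apply: (@tamagawa_chvar _ v _ 1 0 0 (g * s) _ (oner_neq0 K)).
rewrite shift; apply: (tamagawa_reduced pp Qp).
  apply: cusp_reduced; first by apply: (cusp_singular e12) => //; rewrite ?vge0 //; apply: veq_vge.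
  rewrite -shift -[disc _]mul1r -[X in X * _](expr1n _ 12) disc_chvar ?oner_neq0 //.
by apply: (index_cusp_three Qp e12) => //; apply: veq_vge.
Qed.

(** Writing y = g (3 w + 1), the quadratic is g^2 (9 (w^2 + w + 1) + d), of valuation exactly 2 e,
    so no point reduces to the cusp. *)
Lemma tamagawa_Et_at_A_nonsplit : (p %% 6 = 2 \/ p %% 6 = 5)%N -> tamagawa v Et 1.
Proof.
move=> p6; apply: (@tamagawa_chvar _ v Et u 0 0 0 _ u0).
apply: (tamagawa_reduced pp Qp (cusp_reduced singular_Et disc_Et_val)).
rewrite scale_Et; apply: (index_cusp_one Qp e12) => //; first exact: veq_vge.
move=> y ye; have g0 := veq_neq0 ge.
have yg : vge v (y / g) 0 by rewrite (vge_div Qp _ _ ge) add0r.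
have i3 : vge v 3^-1 0 by apply: (veq_vge (veqV Qp three)).
have wu := @no_cube_root_of_unity ((y / g - 1) / 3) p6 ltac:(vsolve Qp).
have /andP[//] : veq v (y ^+ 2 + g * y - - g ^+ 2 * (7 + d)) (2 * e).
rewrite (_ : _ - _ = g ^+ 2 * (9 * (((y / g - 1) / 3) ^+ 2 + (y / g - 1) / 3 + 1) + d)); last first.
  by field; rewrite ?g0 ?(natr_neq0 Qp).
rewrite -[2 * e]addr0; apply: (veqM Qp); first exact: (veqX Qp 2).
have nine : veq v 9 0 by rewrite (_ : 9 = 3 ^+ 2); [apply: (veqX0 Qp) | ring].
by apply: (veqD Qp) => //; rewrite -[0]addr0; apply: (veqM Qp).
Qed.

End PrimeDividesA.

End Models.

Lemma EC3E (K : fieldType) (a b : int) :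
  EC3 K a b = Weier a%:~R 0 (a%:~R ^+ 2 * b%:~R) 0 0.
Proof. by rewrite /EC3 rmorphM rmorphXn. Qed.

Lemma EC3tE (K : fieldType) (a b : int) (A := a%:~R : K) (B := b%:~R : K) :
  EC3t K a b = Weier A 0 (A ^+ 2 * B) (- 5 * A ^+ 3 * B) (- (A ^+ 4 * B * (A + 7 * B))).
Proof. by rewrite /EC3t !(rmorphM, rmorphN, rmorphD, rmorphXn). Qed.

Theorem theorem3p1 (a b : int) (Hcop : coprimez a b) (Ha : 0 < a) (Hb : b != 0)
  (H27 : a != 27 * b) :
  (* (i) *)
  (forall (p : nat) (K : fieldType) (v : K -> int), prime p -> Qp_field p v ->
     let n := logn p (absz b) in (0 < n)%N ->
     [/\ bad_reduction v (EC3 K a b), bad_reduction v (EC3t K a b),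
         tamagawa v (EC3 K a b) (3 * n) & tamagawa v (EC3t K a b) n]) /\
  (* (ii) *)
  (forall (p : nat) (K : fieldType) (v : K -> int), prime p -> Qp_field p v ->
     p != 3%N -> ~~ (p %| absz b)%N ->
     let n := logn p (absz (a - 27 * b)%R) in
     [/\ (bad_reduction v (EC3 K a b) <->
            (0 < n)%N \/ (logn p (absz a) %% 3 != 0)%N),
         (bad_reduction v (EC3t K a b) <->
            (0 < n)%N \/ (logn p (absz a) %% 3 != 0)%N),
         ((0 < n)%N -> (p %% 6 = 1)%N ->
            tamagawa v (EC3 K a b) n /\ tamagawa v (EC3t K a b) (3 * n)),
         ((0 < n)%N -> (p %% 6 = 2 \/ p %% 6 = 5)%N ->
            if ~~ odd n then tamagawa v (EC3 K a b) 2 /\ tamagawa v (EC3t K a b) 2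
            else tamagawa v (EC3 K a b) 1 /\ tamagawa v (EC3t K a b) 1) &
         ((logn p (absz a) %% 3 != 0)%N ->
            [/\ tamagawa v (EC3 K a b) 3,
                ((p %% 6 = 1)%N -> tamagawa v (EC3t K a b) 3) &
                ((p %% 6 = 2 \/ p %% 6 = 5)%N -> tamagawa v (EC3t K a b) 1)])]).
Proof.
have dvd_lt q k : prime q -> k != 0 :> int -> (0 < logn q `|k|)%N = (q %| `|k|)%N.
  by move=> qp k0; rewrite logn_gt0 mem_primes qp absz_gt0 k0.
have a0 : a != 0 by rewrite gt_eqF.
have D0 : a - 27 * b != 0 by rewrite subr_eq0.
split=> p K v pp Qp => [n n0|p3 pb n]; rewrite EC3E EC3tE.
  have pb : (p %| `|b|)%N by rewrite -dvd_lt.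
  have pa : ~~ (p %| `|a|)%N.
    apply/negP => pa; have : (p %| gcdn `|a| `|b|)%N by rewrite dvdn_gcd pa.
    move: Hcop; rewrite coprimezE /coprime => /eqP->.
    by rewrite dvdn1 => /eqP p1; move: pp; rewrite p1.
  apply: (curves_at_prime_dividing_b pp Qp n0); first exact: (unit_int Qp pp).
  exact: (veq_int Qp Hb).
have B0 := unit_int Qp pp pb.
have Dn : veq v (a%:~R - 27 * b%:~R) n.
  by have := veq_int Qp D0 (erefl n); rewrite rmorphB rmorphM.
have Am := veq_int Qp a0 (erefl (logn p `|a|)).
(* A prime dividing both a and a - 27 b divides 27 b, which is excluded here; so the two kinds of
   bad reduction never meet. *)
have nA : (0 < n)%N -> logn p `|a| = 0%N.
  rewrite dvd_lt // => pD; apply/eqP; rewrite -leqn0 leqNgt dvd_lt //.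
  apply/negP => pa; have : (p %| `|(27 * b)%R|)%N.
    rewrite (_ : 27 * b = a - (a - 27 * b)); last by ring.
    exact: (rpredB (pa : a \in dvdz p%:Z) (pD : a - 27 * b \in dvdz p%:Z)).
  rewrite abszM Euclid_dvdM // (negPf pb) orbF (_ : `|27| = 3 ^ 3)%N //.
  by rewrite Euclid_dvdX // dvdn_prime2 // (negPf p3).
set m := logn p `|a| in Am nA *.
have bad_n : (0 < n)%N -> bad_reduction v (Weier a%:~R 0 (a%:~R ^+ 2 * b%:~R) 0 0)
    /\ bad_reduction v (Weier a%:~R 0 (a%:~R ^+ 2 * b%:~R) (- 5 * a%:~R ^+ 3 * b%:~R)
    (- (a%:~R ^+ 4 * b%:~R * (a%:~R + 7 * b%:~R)))).
  move=> n0; rewrite nA // in Am.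
  exact: (bad_reduction_at_D pp Qp p3 n0 Am B0 Dn).
have typeIV : (m %% 3 != 0)%N ->
    exists k e, [/\ 1 <= e <= 2 & veq v (a%:~R : K) (3 * k%:Z + 3 - e)].
  move=> m3; exists (m %/ 3)%N, (3 - (m %% 3)%:Z); split; first by clear -m3; lia.
  by rewrite (_ : 3 * _ + _ - _ = m%:Z) //; clear; lia.
have bad_m : (m %% 3 != 0)%N -> bad_reduction v (Weier a%:~R 0 (a%:~R ^+ 2 * b%:~R) 0 0)
    /\ bad_reduction v (Weier a%:~R 0 (a%:~R ^+ 2 * b%:~R) (- 5 * a%:~R ^+ 3 * b%:~R)
    (- (a%:~R ^+ 4 * b%:~R * (a%:~R + 7 * b%:~R)))).
  by move=> /typeIV[k [e [e12 Ak]]]; apply: (bad_reduction_at_A pp Qp p3 e12 Ak B0).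
have good : ~ ((0 < n)%N \/ (m %% 3 != 0)%N) ->
    ~ bad_reduction v (Weier a%:~R 0 (a%:~R ^+ 2 * b%:~R) 0 0)
    /\ ~ bad_reduction v (Weier a%:~R 0 (a%:~R ^+ 2 * b%:~R) (- 5 * a%:~R ^+ 3 * b%:~R)
    (- (a%:~R ^+ 4 * b%:~R * (a%:~R + 7 * b%:~R)))).
  move=> h; have n0 : n = 0%N by apply/eqP; rewrite -leqn0 leqNgt; apply/negP => n0; apply: h; left.
  have m3 : m = (3 * (m %/ 3))%N.
    have : (m %% 3 == 0)%N by apply/negPn/negP => m3; apply: h; right.
    by clear; lia.
  by rewrite m3 in Am; rewrite n0 in Dn; apply: (good_reduction pp Qp p3 Am B0 Dn).
have dec : (0 < n)%N \/ (m %% 3 != 0)%N \/ ~ ((0 < n)%N \/ (m %% 3 != 0)%N).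
  case: (0 < n)%N; first by left.
  by case: (m %% 3 != 0)%N; right; [left | right => -[]].
split.
- split; first by case: dec => [?|[?|/good[]//]]; [left|right].
  by case=> [/bad_n|/bad_m] [].
- split; first by case: dec => [?|[?|/good[]//]]; [left|right].
  by case=> [/bad_n|/bad_m] [].
- by move=> n0; rewrite nA // in Am; apply: (tamagawa_at_D_split pp Qp p3 n0 Am B0 Dn).
- move=> n0 p6; rewrite nA // in Am.
  by have := tamagawa_at_D_nonsplit pp Qp p3 n0 Am B0 Dn p6; case: (~~ odd n).
- move=> /typeIV[k [e [e12 Ak]]]; split.
  + exact: (tamagawa_E_at_A pp Qp p3 e12 Ak B0).
  + exact: (tamagawa_Et_at_A_split pp Qp p3 e12 Ak B0).
  + exact: (tamagawa_Et_at_A_nonsplit pp Qp p3 e12 Ak B0).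
Qed.
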